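(* Let $H$ be a separable infinite-dimensional complex Hilbert space. Each of the subspaces $\mathcal R_K^-(H)$, $\mathcal R_K^+(H)$ and $\mathcal R_K^\star(H)$ is dense in $\mathcal R_K^{\mathrm{sa}}(H)$ in the graph topology.
   Context: A regular operator on $H$ is a closed, densely defined linear operator on $H$. $\mathcal R_K^{\mathrm{sa}}(H)$ is the set of self-adjoint regular operators $A$ with compact resolvent, i.e. with $(1+A^2)^{-1}$ compact. The graph topology is induced by the injective map sending $A$ to the orthogonal projection of $H\oplus H$ onto the graph of $A$, from the norm topology on projections. A bounded self-adjoint operator is essentially positive (resp. essentially negative) if it is $\ge0$ (resp. $\le0$) on some invariant subspace of finite codimension; a self-adjoint regular operator $A$ is essentially positive (resp. negative) if its bounded transform $A(1+A^*A)^{-1/2}$ is. $\mathcal R_K^+(H)$ and $\mathcal R_K^-(H)$ are the subsets of $\mathcal R_K^{\mathrm{sa}}(H)$ of essentially positive, resp. essentially negative operators, and $\mathcal R_K^\star(H)=\mathcal R_K^{\mathrm{sa}}(H)\setminus(\mathcal R_K^+(H)\cup\mathcal R_K^-(H))$. *)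

(* Defs.v *)
From HB Require Import structures.
From mathcomp Require Import all_boot all_order all_algebra.
From mathcomp Require Import all_classical all_reals topology normedtype.
From mathcomp Require Import complex ring.

Set Implicit Arguments.
Unset Strict Implicit.
Unset Printing Implicit Defensive.

Import Order.TTheory GRing.Theory Num.Theory.
Import numFieldNormedType.Exports.

Local Open Scope classical_set_scope.
Local Open Scope ring_scope.

(* [inner] is linear in its first argument and conjugate-linear in its second. *)
HB.mixin Record CompleteNormedModule_isHilbert (R : realType) H
    & CompleteNormedModule R[i] H := {
  inner : {dot H for @Num.conj R[i]} ;
  innerxx : forall x : H, inner x x = `|x| ^+ 2
}.

#[short(type="hilbertType")]
HB.structure Definition Hilbert (R : realType) :=
  {H of CompleteNormedModule R[i] H & CompleteNormedModule_isHilbert R H}.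

(* Same carrier as [H * H], which the library equips with the max norm. *)
Definition hsum (H : Type) : Type := (H * H)%type.

Section HilbertSum.
Context {R : realType} (H : hilbertType R).
Implicit Types z w : hsum H.

HB.instance Definition _ := GRing.Lmodule.copy (hsum H) (H * H)%type.

Definition hsum_norm z : R[i] := sqrtC (`|z.1| ^+ 2 + `|z.2| ^+ 2).

Definition hsum_inner z w : R[i] := inner z.1 w.1 + inner z.2 w.2.

Let sq_ge0 z : 0 <= `|z.1| ^+ 2 + `|z.2| ^+ 2.
Proof. by rewrite addr_ge0 // exprn_ge0. Qed.

Let hsum_norm_ge0 z : 0 <= hsum_norm z.
Proof. by rewrite sqrtC_ge0. Qed.

Let ler_sqr (x y : R[i]) : 0 <= x -> 0 <= y -> x ^+ 2 <= y ^+ 2 -> x <= y.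
Proof. by move=> x0 y0; rewrite ler_pXn2r // ?nnegrE. Qed.

Let hsum_normD z w : hsum_norm (z + w) <= hsum_norm z + hsum_norm w.
Proof.
apply: ler_sqr => //; first exact: addr_ge0.
rewrite sqrrD !sqrtCK /=.
set a := `|z.1|; set b := `|z.2|; set c := `|w.1|; set d := `|w.2|.
have [a0 b0 c0 d0] : [/\ 0 <= a, 0 <= b, 0 <= c & 0 <= d].
  by split; exact: normr_ge0.
apply: (@le_trans _ _ ((a + c) ^+ 2 + (b + d) ^+ 2)).
  by rewrite lerD // ler_pXn2r ?nnegrE ?addr_ge0 // ler_normD.
have -> : (a + c) ^+ 2 + (b + d) ^+ 2 =
    (a ^+ 2 + b ^+ 2) + (a * c + b * d) *+ 2 + (c ^+ 2 + d ^+ 2).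
  by rewrite !sqrrD mulrnDl addrACA; congr (_ + _); rewrite addrACA.
rewrite lerD2r lerD2l lerMn2r /=.
apply: ler_sqr; rewrite ?addr_ge0 ?mulr_ge0 //.
rewrite exprMn !sqrtCK -subr_ge0.
have -> : (a ^+ 2 + b ^+ 2) * (c ^+ 2 + d ^+ 2) - (a * c + b * d) ^+ 2 =
    (a * d - b * c) ^+ 2.
  by ring.
by rewrite real_exprn_even_ge0 // rpredB // rpredM // ger0_real.
Qed.

Let hsum_normZ (a : R[i]) z : hsum_norm (a *: z) = `|a| * hsum_norm z.
Proof.
rewrite /hsum_norm /= !normrZ !exprMn -mulrDr sqrtCM ?nnegrE ?exprn_ge0 //.
by rewrite sqrCK.
Qed.

Let hsum_norm0_eq0 z : hsum_norm z = 0 -> z = 0.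
Proof.
move=> /eqP; rewrite sqrtC_eq0 paddr_eq0 ?exprn_ge0 // !expf_eq0 /= !normr_eq0.
by case: z => x y /= /andP[/eqP -> /eqP ->].
Qed.

HB.instance Definition _ :=
  Lmodule_isNormed.Build R[i] (hsum H) hsum_normD hsum_normZ hsum_norm0_eq0.

Let hsum_normE z : `|z| = hsum_norm z. Proof. by []. Qed.

Let norm1_le z : `|z.1| <= `|z|.
Proof.
by apply: ler_sqr => //; rewrite hsum_normE sqrtCK lerDl exprn_ge0.
Qed.

Let norm2_le z : `|z.2| <= `|z|.
Proof.
by apply: ler_sqr => //; rewrite hsum_normE sqrtCK lerDr exprn_ge0.
Qed.

Let norm_le z : `|z| <= `|z.1| + `|z.2|.
Proof.
apply: ler_sqr => //; first exact: addr_ge0.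
by rewrite hsum_normE sqrtCK sqrrD lerD2r lerDl mulrn_wge0 // mulr_ge0.
Qed.

Let hsum_complete (F : set_system (hsum H)) :
  ProperFilter F -> cauchy F -> cvg F.
Proof.
move=> FF /cauchyP Fc.
have c1 : cauchy (fst @ F).
  apply/cauchyP => e e0; have [x Fx] := Fc _ e0; exists x.1.
  suff : F (fst @^-1` ball x.1 e) by [].
  apply: filterS Fx => z; rewrite -!ball_normE /=.
  by apply: le_lt_trans; exact: (norm1_le (x - z)).
have c2 : cauchy (snd @ F).
  apply/cauchyP => e e0; have [x Fx] := Fc _ e0; exists x.2.
  suff : F (snd @^-1` ball x.2 e) by [].
  apply: filterS Fx => z; rewrite -!ball_normE /=.
  by apply: le_lt_trans; exact: (norm2_le (x - z)).
have F1 : ProperFilter (fst @ F) := fmap_proper_filter _ FF.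
have Fl1 : (fst @ F) --> lim (fst @ F) by exact: cauchy_cvg c1.
have F2 : ProperFilter (snd @ F) := fmap_proper_filter _ FF.
have Fl2 : (snd @ F) --> lim (snd @ F) by exact: cauchy_cvg c2.
have D1 := (@cvgrPdist_lt _ H _ F _ fst (lim (fst @ F))).1 Fl1.
have D2 := (@cvgrPdist_lt _ H _ F _ snd (lim (snd @ F))).1 Fl2.
apply/cvg_ex; exists ((lim (fst @ F), lim (snd @ F)) : hsum H).
apply/cvgrPdist_lt => e e0; near=> z.
apply: (le_lt_trans (norm_le _)) => /=.
rewrite [ltRHS](splitr e) ltrD //; near: z.
  by apply: D1; rewrite divr_gt0.
by apply: D2; rewrite divr_gt0.
Unshelve. all: end_near. Qed.

HB.instance Definition _ := Uniform_isComplete.Build (hsum H) hsum_complete.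

Let hsum_inner_bilinear :
  bilinear_for *%R (@Num.conj R[i] \; *%R) hsum_inner.
Proof.
split=> z a u v; rewrite /hsum_inner /=.
- by rewrite !linearPl /= mulrDr addrACA.
- by rewrite !linearPr /= mulrDr addrACA.
Qed.

HB.instance Definition _ := bilinear_isBilinear.Build R[i] (hsum H) (hsum H) R[i]
  *%R (@Num.conj R[i] \; *%R) hsum_inner hsum_inner_bilinear.

Let hsum_inner_herm z w :
  hsum_inner z w = (-1) ^+ false * (hsum_inner w z)^*.
Proof.
have hC := hermC (@inner R H).
by rewrite /hsum_inner hC (hC z.2) rmorphD mulrDr.
Qed.

Let hsum_innerxx z : hsum_inner z z = `|z| ^+ 2.
Proof. by rewrite /hsum_inner !innerxx hsum_normE sqrtCK. Qed.

Let hsum_inner_gt0 z : z != 0 -> 0 < hsum_inner z z.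
Proof. by move=> z0; rewrite hsum_innerxx exprn_gt0 // normr_gt0. Qed.

HB.instance Definition _ :=
  isHermitianSesquilinear.Build R[i] (hsum H) false Num.conj hsum_inner
    hsum_inner_herm.
HB.instance Definition _ :=
  isDotProduct.Build R[i] (hsum H) hsum_inner hsum_inner_gt0.
HB.instance Definition _ :=
  CompleteNormedModule_isHilbert.Build R (hsum H) hsum_innerxx.

End HilbertSum.

Section BoundedOperators.
Context {R : realType} (E : hilbertType R).

Record bop := Bop {
  bop_fun :> E -> E ;
  bop_linear : linear bop_fun ;
  bop_continuous : continuous bop_fun
}.

HB.instance Definition _ (T : bop) :=
  GRing.isLinear.Build R[i] E E *:%R (bop_fun T) (bop_linear T).

HB.instance Definition _ := gen_eqMixin bop.
HB.instance Definition _ := gen_choiceMixin bop.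

Let bop0_linear : linear (fun _ : E => 0 : E).
Proof. by move=> a x y; rewrite scaler0 addr0. Qed.

HB.instance Definition _ := isPointed.Build bop
  (Bop bop0_linear (fun x => cvg_cst (0 : E))).

(* Norms of vectors are valued in R[i]; [complex.Re] sends them to R. *)
Definition opnorm (f : E -> E) : R :=
  sup [set complex.Re `|f x| | x in [set x : E | `|x| <= 1]].

Implicit Types (x y : E) (S T U : bop).

Let rnorm (x : E) : R := complex.Re `|x|.

Let rnormE x : `|x| = (rnorm x)%:C%C.
Proof. by rewrite RRe_real // normr_real. Qed.

Let ler_rnormD x y : rnorm (x + y) <= rnorm x + rnorm y.
Proof. by have := ler_normD x y; rewrite !rnormE -rmorphD lecR. Qed.

Let bop_bounded (T : bop) : exists M, forall x, `|x| <= 1 -> rnorm (T x) <= M.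
Proof.
have /linear_bounded_continuous/linear_boundedP := @bop_continuous T.
move=> /pinfty_ex_gt0 [M M0 TM]; exists (complex.Re M) => x x1.
have : `|T x| <= M by rewrite (le_trans (TM x)) // ler_piMr // ltW.
by rewrite lecE => /andP[].
Qed.

Let has_ub (S T : bop) :
  has_ubound [set complex.Re `|S x - T x| | x in [set x : E | `|x| <= 1]].
Proof.
have [[M SM] [N TN]] := (bop_bounded S, bop_bounded T).
exists (M + N) => _ [x x1 <-]; rewrite -[_ `|_|]/(rnorm _).
rewrite (le_trans (ler_rnormD _ _)) // lerD ?SM //.
by rewrite /rnorm normrN TN.
Qed.

Let bop_dist (S T : bop) : R := opnorm (fun x => S x - T x).

Let le_dist S T x : `|x| <= 1 -> rnorm (S x - T x) <= bop_dist S T.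
Proof. by move=> x1; apply: ub_le_sup; [exact: has_ub|exists x]. Qed.

Let dist_le S T M :
  (forall x, `|x| <= 1 -> rnorm (S x - T x) <= M) -> bop_dist S T <= M.
Proof.
move=> STM; apply: ge_sup; last by move=> _ [x x1 <-]; exact: STM.
by exists (rnorm (S 0 - T 0)), 0 => //=; rewrite normr0.
Qed.

Let bop_distxx T : bop_dist T T = 0.
Proof.
apply/eqP; rewrite eq_le dist_le /=; last first.
  by move=> x _; rewrite /rnorm subrr normr0.
by apply: le_trans (@le_dist T T 0 _); rewrite ?normr0 // /rnorm subrr normr0.
Qed.

Let bop_dist_positivity S T : bop_dist S T = 0 -> S = T.
Proof.
move=> ST0.
have ST1 x : `|x| <= 1 -> S x = T x.
  move=> x1; apply/eqP; rewrite -subr_eq0 -normr_eq0 eq_le normr_ge0 andbT.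
  by rewrite rnormE -(rmorph0 (real_complex R)) lecR -ST0 le_dist.
have STE : bop_fun S = bop_fun T.
  apply/funext => x; have [->|x0] := eqVneq x 0; first by rewrite !linear0.
  have x0' : `|x| != 0 by rewrite normr_eq0.
  have := ST1 (`|x|^-1 *: x); rewrite !linearZ normrZ normfV normr_id mulVf //.
  by move=> /(_ (lexx _)) /scalerI -> //; rewrite invr_eq0.
case: S T STE {ST0 ST1} => [f fl fc] [g gl gc] /= fg.
by subst g; congr Bop; exact: Prop_irrelevance.
Qed.

Let bop_dist_sym S T : bop_dist S T = bop_dist T S.
Proof.
by congr sup; apply/eq_imagel => x _; rewrite distrC.
Qed.

Let bop_dist_triangle T S U : bop_dist S U <= bop_dist S T + bop_dist T U.
Proof.
apply: dist_le => x x1; rewrite -(subrKA (T x)).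
by rewrite (le_trans (ler_rnormD _ _)) // lerD // le_dist.
Qed.

HB.instance Definition _ := isMetric.Build R bop
  bop_distxx bop_dist_positivity bop_dist_sym bop_dist_triangle.

Definition bop_positive (T : bop) := forall x, 0 <= inner (T x) x.

Definition compact_operator (T : bop) :=
  precompact (T @` [set x : E | `|x| <= 1]).

Definition orthogonal_projection (G : set E) (P : bop) :=
  forall x, G (P x) /\ forall y, G y -> inner (x - P x) y = 0.

Definition finite_codim (W : set E) :=
  exists n (v : 'I_n -> E), forall x,
    exists c : 'I_n -> R[i], W (x - \sum_(i < n) c i *: v i).

Definition ess_positive (T : bop) := exists W : set E,
  [/\ submod_closed (mem W), finite_codim W, T @` W `<=` W &
      forall x, W x -> 0 <= inner (T x) x].

Definition ess_negative (T : bop) := exists W : set E,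
  [/\ submod_closed (mem W), finite_codim W, T @` W `<=` W &
      forall x, W x -> inner (T x) x <= 0].

End BoundedOperators.

Definition finite_dim {R : realType} (E : hilbertType R) :=
  exists n (v : 'I_n -> E), forall x,
    exists c : 'I_n -> R[i], x = \sum_(i < n) c i *: v i.

Section Graphs.
Context {R : realType} {H : hilbertType R}.
Implicit Types F G : set (hsum H).

(* Unbounded operators are combined through their graphs (linear relations), so
   that domains of inverses, adjoints, sums and compositions are the natural
   ones. *)
Definition fun_graph (f : H -> H) : set (hsum H) := [set z | z.2 = f z.1].
Definition inv_graph G : set (hsum H) := [set z | G (z.2, z.1)].
Definition comp_graph G F : set (hsum H) :=
  [set z | exists2 y, F (z.1, y) & G (y, z.2)].
Definition one_plus_graph G : set (hsum H) := [set z | G (z.1, z.2 - z.1)].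
Definition adj_graph G : set (hsum H) :=
  [set z | forall x y, G (x, y) -> inner y z.1 = inner x z.2].
End Graphs.

Section RegularOperators.
Context {R : realType} (H : hilbertType R).

(* [regular_fun] is extended by 0 outside [dom], so that equality of the
   records is equality of the partial operators. *)
Record regular := Regular {
  dom : set H ;
  regular_fun :> H -> H ;
  dom_submod : submod_closed (mem dom) ;
  dom_dense : dense dom ;
  regular_linear : forall a x y, dom x -> dom y ->
    regular_fun (a *: x + y) = a *: regular_fun x + regular_fun y ;
  regular_out : forall x, ~ dom x -> regular_fun x = 0 ;
  regular_closed : closed [set z : hsum H | dom z.1 /\ z.2 = regular_fun z.1]
}.

Definition graph (A : regular) : set (hsum H) :=
  [set z | dom A z.1 /\ z.2 = A z.1].

Definition self_adjoint (A : regular) := adj_graph (graph A) = graph A.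

Definition compact_resolvent (A : regular) := exists2 T : bop H,
  fun_graph T = inv_graph (one_plus_graph (comp_graph (graph A) (graph A))) &
  compact_operator T.

(* [S] is (1 + A^* A)^{-1/2}, the positive square root of (1 + A^* A)^{-1}. *)
Definition bounded_transform (A : regular) (F : bop H) := exists S : bop H,
  [/\ bop_positive S,
      fun_graph (S \o S) =
        inv_graph (one_plus_graph (comp_graph (adj_graph (graph A)) (graph A)))
    & fun_graph F = comp_graph (graph A) (fun_graph S)].

(* The projection exists and is unique, the graph being a closed subspace. *)
Definition graph_projection (A : regular) : bop (hsum H) :=
  get (orthogonal_projection (graph A)).

Record RKsa := RKSA {
  RKsa_regular :> regular ;
  RKsa_self_adjoint : self_adjoint RKsa_regular ;
  RKsa_compact_resolvent : compact_resolvent RKsa_regular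
}.

HB.instance Definition _ := gen_eqMixin RKsa.
HB.instance Definition _ := gen_choiceMixin RKsa.

(* The graph topology, from the operator-norm metric on [bop (hsum H)]. *)
HB.instance Definition _ := Topological.copy RKsa
  (initial_topology (fun A : RKsa => graph_projection A)).

Definition RKplus : set RKsa :=
  [set A | exists2 F, bounded_transform A F & ess_positive F].
Definition RKminus : set RKsa :=
  [set A | exists2 F, bounded_transform A F & ess_negative F].
Definition RKstar : set RKsa := ~` (RKplus `|` RKminus).

End RegularOperators.

Arguments RKplus {R} H _.
Arguments RKminus {R} H _.
Arguments RKstar {R} H _.

(* Main.v *)
Require Import Defs.
From mathcomp Require Import all_boot all_order all_algebra.
From mathcomp Require Import all_classical all_reals topology normedtype.
From mathcomp Require Import complex ring lra.
From mathcomp Require Import derive.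

(** A self-adjoint operator [A] with compact resolvent is diagonal in an
    orthonormal basis [e n], with real eigenvalues [l n] such that [|l n|] tends
    to infinity.  Flipping the sign of an eigenvalue [l] leaves [(1 + A^2)^-1]
    unchanged, and changes the projection onto the graph only through its
    off-diagonal entry [l / (1 + l^2)], which is small when [|l|] is large.
    Hence, up to a small change of the graph projection, the signs of all but
    finitely many eigenvalues can be prescribed at will: all positive, all
    negative, or alternating. *)

Set Implicit Arguments.
Unset Strict Implicit.
Unset Printing Implicit Defensive.

Import Order.TTheory GRing.Theory Num.Theory.
Import numFieldNormedType.Exports.

Local Open Scope classical_set_scope.
Local Open Scope ring_scope.

(** * Inner products *)

(** Domains are the main obstacle to building operators from eigenvalues. A diagonal operator is
    therefore given by coordinate equations on its graph, and the Riesz-Fischer theorem supplies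
    both the vectors with prescribed coordinates and the norm bounds. The eigenbasis itself comes
    from compactness: the norm attains its maximum on the compact closure of an image under the
    resolvent, which gives an eigenvector in every nonzero reducing subspace. Separability makes the
    resulting orthonormal set countable, and infinite dimension makes it infinite.

    For the alternating case, the subspaces in the definition of essential positivity and negativity
    bear no relation to the eigenbasis. A dimension count settles this: a subspace of finite
    codimension contains a nonzero finite combination of any infinite family of basis vectors, in
    particular of eigenvectors of a single sign. *)

Section InnerProduct.
Context {R : realType} {E : hilbertType R}.
Implicit Types (x y z : E) (a : R[i]).

Lemma ipC x y : inner x y = (inner y x)^*.
Proof. by rewrite (hermC (@inner R E)) expr0 mul1r. Qed.

Lemma ipDl x y z : inner (x + y) z = inner x z + inner y z.
Proof. exact: linearDl. Qed.

Lemma ipZl a x z : inner (a *: x) z = a * inner x z.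
Proof. exact: linearZl_LR. Qed.

Lemma ipBl x y z : inner (x - y) z = inner x z - inner y z.
Proof. exact: linearBl. Qed.

Lemma ipNl x z : inner (- x) z = - inner x z.
Proof. exact: linearNl. Qed.

Lemma ip0l z : inner 0 z = 0.
Proof. exact: linear0l. Qed.

Lemma ip_suml (I : Type) (s : seq I) (P : pred I) (F : I -> E) z :
  inner (\sum_(i <- s | P i) F i) z = \sum_(i <- s | P i) inner (F i) z.
Proof. exact: (big_morph (inner^~ z) (fun x y => ipDl x y z) (ip0l z)). Qed.

Lemma ipDr x y z : inner z (x + y) = inner z x + inner z y.
Proof. exact: linearDr. Qed.

Lemma ipZr a x z : inner z (a *: x) = a^* * inner z x.
Proof. by rewrite ipC ipZl rmorphM /= -ipC. Qed.

Lemma ipBr x y z : inner z (x - y) = inner z x - inner z y.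
Proof. exact: linearBr. Qed.

Lemma ip0r z : inner z 0 = 0.
Proof. exact: linear0r. Qed.

Lemma ip_sumr (I : Type) (s : seq I) (P : pred I) (F : I -> E) z :
  inner z (\sum_(i <- s | P i) F i) = \sum_(i <- s | P i) inner z (F i).
Proof. exact: (big_morph (inner z) (fun x y => ipDr x y z) (ip0r z)). Qed.

Lemma ip_ge0 x : 0 <= inner x x.
Proof. by rewrite innerxx exprn_ge0. Qed.

Lemma ip_eq0 x : inner x x = 0 -> x = 0.
Proof. by move/eqP; rewrite innerxx expf_eq0 /= normr_eq0 => /eqP. Qed.

Lemma ler_sqrC (u v : R[i]) : 0 <= u -> 0 <= v -> (u ^+ 2 <= v ^+ 2) = (u <= v).
Proof. by move=> u0 v0; rewrite ler_pXn2r // nnegrE. Qed.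

Lemma pythagoras x y : inner x y = 0 -> `|x + y| ^+ 2 = `|x| ^+ 2 + `|y| ^+ 2.
Proof.
move=> xy; rewrite -!innerxx !ipDl !ipDr xy (ipC y) xy rmorph0; ring.
Qed.

Lemma cauchy_schwarz x y : `|inner x y| <= `|x| * `|y|.
Proof.
have [->|y0] := eqVneq y 0; first by rewrite ip0r !normr0 mulr0.
have yy0 : inner y y != 0 by rewrite innerxx expf_eq0 normr_eq0.
(* [c *: y] is the orthogonal projection of [x] onto the line of [y]. *)
set c := inner x y / inner y y.
have xE : x = (x - c *: y) + c *: y by rewrite subrK.
have o : inner (x - c *: y) (c *: y) = 0.
  by rewrite ipZr ipBl ipZl /c divfK // subrr mulr0.
rewrite -ler_sqrC ?mulr_ge0 // exprMn {2}xE pythagoras //.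
have -> : `|inner x y| = `|c *: y| * `|y|.
  rewrite normrZ /c innerxx normrM normfV normrX normr_id.
  by rewrite -mulrA -expr2 divfK // expf_neq0 // normr_eq0.
by rewrite exprMn ler_wpM2r ?exprn_ge0 // lerDr exprn_ge0.
Qed.

Lemma lipschitz_continuous (V W : normedModType R[i]) (f : V -> W) (C : R[i]) :
  (forall x y : V, `|f x - f y| <= C * `|x - y|) -> continuous f.
Proof.
move=> fC x; apply/(@cvgrPdist_lt _ _ _ (nbhs x)) => e e0.
have C1 : 0 < `|C| + 1 by rewrite ltr_wpDl.
near=> y.
rewrite (le_lt_trans (fC _ _)) //.
have [<-|/eqP xy] := pselect (x = y); first by rewrite subrr normr0 mulr0.
(* [C] is any element of [R[i]]; a pair of distinct points forces it to be real and nonnegative. *)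
have C0 : 0 <= C.
  have := le_trans (normr_ge0 _) (fC x y).
  by rewrite pmulr_lge0 // normr_gt0 subr_eq0.
rewrite (@le_lt_trans _ _ ((`|C| + 1) * `|x - y|)) //.
  by rewrite ler_wpM2r // ger0_norm // lerDl.
rewrite mulrC -ltr_pdivlMr //; near: y.
by apply: cvgr_dist_lt => //; rewrite divr_gt0.
Unshelve. all: end_near. Qed.

(** Limit arguments below end here: an equality is reduced to an estimate of a norm by a fixed
    multiple of an arbitrary positive [e]. *)
Lemma eq0_small (u C : R[i]) : 0 <= u -> 0 <= C ->
  (forall e, 0 < e -> u <= C * e) -> u = 0.
Proof.
move=> u0 C0 uC; apply/eqP; rewrite eq_le u0 andbT.
have C1 : 0 < C + 1 by rewrite ltr_wpDl.
apply/negP => /negP; rewrite real_leNgt ?ger0_real // negbK => u1.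
(* Dividing by [C + 1] instead of [C] also covers [C = 0]. *)
have e0 : 0 < u / (C + 1) / 2 by rewrite !divr_gt0.
have := uC _ e0; apply/negP.
rewrite -real_ltNge ?ger0_real ?mulr_ge0 ?(ltW e0) //.
rewrite !mulrA ltr_pdivrMr // ltr_pdivrMr // mulrC -subr_gt0.
rewrite (_ : _ - _ = u * (C + 2)); last by ring.
  by rewrite mulr_gt0 // ltr_wpDl.
all: by rewrite invr_ge0 // ltW.
Qed.

Lemma closure_dist (V : normedModType R[i]) (A : set V) (x : V) :
  closure A x <-> forall e, 0 < e -> exists2 y, A y & `|x - y| < e.
Proof.
split=> [Ax e e0|Ax B].
  by have [y [Ay +]] := Ax _ (nbhsx_ballx x e e0); rewrite -ball_normE;
    exists y.
move=> /nbhs_ballP [e e0]; rewrite -ball_normE => eB.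
by have [y Ay xy] := Ax _ e0; exists y; split => //; exact: eB.
Qed.

Lemma closed_ip_eq0 z : closed [set x : E | inner x z = 0].
Proof.
move=> x /closure_dist xz /=; apply/eqP; rewrite -normr_eq0; apply/eqP.
apply: (@eq0_small _ `|z|) => // e /xz[y /= yz xy].
rewrite -[x](subrK y) ipDl yz addr0 (le_trans (cauchy_schwarz _ _)) //.
by rewrite mulrC ler_wpM2l // ltW.
Qed.

Lemma bounded_op_continuous (f : E -> E) (C : R[i]) :
  linear f -> (forall x, `|f x| <= C * `|x|) -> continuous f.
Proof.
move=> fl fC; apply: (@lipschitz_continuous _ _ _ C) => x y.
have -> : f x - f y = f (x - y).
  by rewrite addrC -(scaleN1r (f y)) -fl scaleN1r addrC.
exact: fC.
Qed.

End InnerProduct.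

(** * Orthonormal sequences *)

Section Orthonormal.
Context {R : realType} {E : hilbertType R} (e : nat -> E).
Hypothesis he : forall i j, inner (e i) (e j) = (i == j)%:R.
Implicit Types (c : nat -> R[i]) (x y z : E).

Lemma ip_sum_orthonormal (r : seq nat) c k : uniq r ->
  inner (\sum_(i <- r) c i *: e i) (e k) = if k \in r then c k else 0.
Proof.
move=> ur; rewrite ip_suml; case: ifPn => kr.
  rewrite (bigD1_seq k) //= big1 ?addr0 ?ipZl ?he ?eqxx ?mulr1 // => i ik.
  by rewrite ipZl he (negPf ik) mulr0.
rewrite big_seq big1 // => i ir; rewrite ipZl he.
by case: eqP kr => [<-|]; rewrite ?ir // mulr0.
Qed.

Lemma norm_sum_orthonormal (r : seq nat) c : uniq r ->
  `|\sum_(i <- r) c i *: e i| ^+ 2 = \sum_(i <- r) `|c i| ^+ 2.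
Proof.
move=> ur; rewrite -innerxx ip_sumr big_seq [RHS]big_seq.
apply: eq_bigr => k kr; rewrite ipZr ip_sum_orthonormal // kr mulrC.
by rewrite normCK.
Qed.

Lemma bessel x n : \sum_(0 <= i < n) `|inner x (e i)| ^+ 2 <= `|x| ^+ 2.
Proof.
set s := \sum_(0 <= i < n) inner x (e i) *: e i.
have un : uniq (index_iota 0 n) by exact: iota_uniq.
rewrite -(norm_sum_orthonormal (fun i => inner x (e i))) // -/s.
have o : inner s (x - s) = 0.
  rewrite ip_suml big_seq big1 // => k kn.
  rewrite ipZl ipBr (ipC _ x) (ipC _ s) ip_sum_orthonormal // kn.
  by rewrite subrr mulr0.
by rewrite -[x](subrKC s) pythagoras // lerDl exprn_ge0.
Qed.

Definition partial_sum c n := \sum_(0 <= i < n) c i *: e i.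

(** The squared norms of the partial sums are nondecreasing and bounded, so the partial sums are
    Cauchy. The norm bound on the limit is kept in the conclusion because later estimates on
    operators are read off from it. *)
Lemma riesz_fischer c (M : R[i]) : 0 <= M ->
    (forall n, \sum_(0 <= i < n) `|c i| ^+ 2 <= M ^+ 2) ->
  exists y, [/\ forall n, inner y (e n) = c n, `|y| <= M &
    forall d, 0 < d ->
      exists N, forall n, (N <= n)%N -> `|y - partial_sum c n| < d].
Proof.
(* Suprema are taken in [R], hence the real part. *)
move=> M0 cM; pose v n := complex.Re (\sum_(0 <= i < n) `|c i| ^+ 2).
have sE m n : (m <= n)%N -> `|partial_sum c n - partial_sum c m| ^+ 2 =
    \sum_(0 <= i < n) `|c i| ^+ 2 - \sum_(0 <= i < m) `|c i| ^+ 2.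
  move=> mn; rewrite /partial_sum (big_cat_nat (leq0n m) mn) //= addrAC subrr
    add0r.
  rewrite [X in _ = X - _](big_cat_nat (leq0n m) mn) //= addrAC subrr add0r.
  by rewrite norm_sum_orthonormal // iota_uniq.
have vE n : \sum_(0 <= i < n) `|c i| ^+ 2 = (v n)%:C%C.
  by rewrite RRe_real // ger0_real // sumr_ge0 // => i _; rewrite exprn_ge0.
have vsup : has_sup (range v).
  split; first by exists (v 0%N), 0%N.
  exists (complex.Re (M ^+ 2)) => _ [n _ <-].
  by have := cM n; rewrite vE lecE => /andP[].
have tail d : 0 < d -> exists N, forall n, (N <= n)%N ->
    `|partial_sum c n - partial_sum c N| < d.
  move=> d0; have d20 : 0 < complex.Re (d ^+ 2).
    by have := exprn_gt0 2 d0; rewrite ltcE => /andP[].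
  have [_ [N _ <-] vN] := sup_adherent d20 vsup.
  exists N => n Nn; rewrite -(@ltr_pXn2r _ 2) // ?nnegrE ?(ltW d0) //.
  rewrite sE // !vE -rmorphB -[d ^+ 2]RRe_real; last first.
    by rewrite rpredX // gtr0_real.
  rewrite ltcR ltrBlDl; have : v n <= sup (range v).
    by apply: ub_le_sup; [case: vsup|exists n].
  by lra.
have : cvg (partial_sum c @ \oo).
  apply/cauchy_cvgP/cauchyP => d d0; have [N Nd] := tail _ d0.
  exists (partial_sum c N); exists N => // n /= Nn.
  by rewrite -ball_normE /= distrC; exact: Nd.
move=> /cvg_ex[y /cvgrPdist_lt ylim].
have {}ylim d : 0 < d -> exists N, forall n, (N <= n)%N ->
    `|y - partial_sum c n| < d.
  by move=> /ylim [N _ Nd]; exists N => n Nn; exact: Nd.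
exists y; split=> // [k|].
  apply/eqP; rewrite -subr_eq0 -normr_eq0; apply/eqP.
  apply: (@eq0_small _ _ 1) => // d /ylim [N Nd].
  have Nk : (N <= maxn N k.+1)%N by rewrite leq_maxl.
  have -> : c k = inner (partial_sum c (maxn N k.+1)) (e k).
    rewrite ip_sum_orthonormal ?iota_uniq //.
    by rewrite mem_index_iota /= leq_max ltnS leqnn orbT.
  rewrite -ipBl (le_trans (cauchy_schwarz _ _)) //.
  have -> : `|e k| = 1.
    by apply/eqP; rewrite -sqrp_eq1 // -innerxx he eqxx.
  by rewrite mulr1 mul1r ltW // Nd.
(* If the norm of [y] exceeded [M], some partial sum would be closer to [y] than the excess,
   although its own norm is at most [M]. *)
rewrite real_leNgt ?ger0_real //; apply/negP => My.
have d0 : 0 < `|y| - M by rewrite subr_gt0.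
have [N /(_ N (leqnn _)) Nd] := ylim _ d0.
have sM : `|partial_sum c N| <= M.
  by rewrite -ler_sqrC // norm_sum_orthonormal ?iota_uniq.
have := ler_normD (y - partial_sum c N) (partial_sum c N); rewrite subrK.
apply/negP; rewrite -real_ltNge ?ger0_real ?addr_ge0 //.
by rewrite -[ltRHS](subrK M) ltr_leD.
Qed.

Hypothesis complete : forall x, (forall n, inner x (e n) = 0) -> x = 0.

Lemma coord_ext x y : (forall n, inner x (e n) = inner y (e n)) -> x = y.
Proof.
move=> xy; apply/eqP; rewrite -subr_eq0; apply/eqP/complete => n.
by rewrite ipBl xy subrr.
Qed.

Lemma coord_exists c x (C : R[i]) : 0 <= C -> (forall n, `|c n| <= C) ->
  exists y, forall n, inner y (e n) = c n * inner x (e n).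
Proof.
move=> C0 cC; have [] := @riesz_fischer (fun n => c n * inner x (e n))
  (C * `|x|).
- by rewrite mulr_ge0.
- move=> n; rewrite exprMn (le_trans _ (ler_wpM2l _ (bessel x n))) ?exprn_ge0
  //.
  rewrite mulr_sumr ler_sum // => i _; rewrite normrM exprMn ler_wpM2r
    ?exprn_ge0 //.
  by rewrite ler_sqrC.
- by move=> y [yc _ _]; exists y.
Qed.

(** Riesz-Fischer produces a vector with the coordinates of [x] that obeys the bound, and
    completeness identifies it with [x]. *)
Lemma coord_norm x y (C : R[i]) : 0 <= C ->
  (forall n, `|inner x (e n)| <= C * `|inner y (e n)|) -> `|x| <= C * `|y|.
Proof.
move=> C0 xy; have [] := @riesz_fischer (fun n => inner x (e n)) (C * `|y|).
- by rewrite mulr_ge0.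
- move=> n; rewrite exprMn (le_trans _ (ler_wpM2l _ (bessel y n))) ?exprn_ge0
  //.
  rewrite mulr_sumr ler_sum // => i _; rewrite -exprMn.
  by rewrite ler_sqrC ?mulr_ge0.
- by move=> z [zc zC _]; rewrite (coord_ext (x := x) (y := z)).
Qed.

(** By completeness [x] is the limit of its partial sums, and Cauchy-Schwarz carries this to inner
    products with [y]. *)
Lemma parseval x y d : 0 < d -> exists N, forall n, (N <= n)%N ->
  `|inner x y - \sum_(0 <= i < n) inner x (e i) * (inner y (e i))^*| < d.
Proof.
move=> d0; have [] := @riesz_fischer (fun n => inner x (e n)) `|x|.
- by [].
- by move=> n; exact: bessel.
move=> z [/coord_ext -> _ zl].
have y1 : 0 < `|y| + 1 by rewrite ltr_wpDl.
have [N Nd] := zl _ (divr_gt0 d0 y1); exists N => n Nn.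
have -> : \sum_(0 <= i < n) inner x (e i) * (inner y (e i))^* =
    inner (partial_sum (fun i => inner x (e i)) n) y.
  by rewrite ip_suml; apply: eq_bigr => i _; rewrite ipZl -ipC.
rewrite -ipBl (le_lt_trans (cauchy_schwarz _ _)) //.
set s := partial_sum _ _; rewrite (@le_lt_trans _ _ (`|x - s| * (`|y| + 1))) //.
  by rewrite ler_wpM2l // lerDl.
by rewrite -ltr_pdivlMr // Nd.
Qed.

Lemma ip_ext x y x' y' :
  (forall n, inner x (e n) * (inner y (e n))^* =
             inner x' (e n) * (inner y' (e n))^*) ->
  inner x y = inner x' y'.
Proof.
move=> xy; apply/eqP; rewrite -subr_eq0 -normr_eq0; apply/eqP.
apply: (@eq0_small _ _ 2) => // d d0.
have [N NP] := parseval x y d0; have [N' NP'] := parseval x' y' d0.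
pose n := maxn N N'; have := NP n (leq_maxl _ _); have := NP' n (leq_maxr _ _).
rewrite (eq_bigr _ (fun i _ => xy i)); set s := \sum_(_ <= _ < _) _ => H' H.
rewrite -(subrKA s) (le_trans (ler_normD _ _)) // mulr2n mulrDl mul1r.
by rewrite lerD // ltW // distrC.
Qed.

Lemma ip_coord_ge0 x y : (forall n, 0 <= inner x (e n) * (inner y (e n))^*) ->
  0 <= inner x y.
Proof.
move=> xy.
(* In the partial order of [R[i]], being nonnegative includes being real, so positivity is proved as
   equality with the modulus. *)
suff -> : inner x y = `|inner x y| by [].
apply/eqP; rewrite -subr_eq0 -normr_eq0; apply/eqP.
apply: (@eq0_small _ _ 2) => // d d0.
have [N /(_ N (leqnn _))] := parseval x y d0.
set s := \sum_(_ <= _ < _) _ => sd.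
have s0 : 0 <= s by apply: sumr_ge0.
rewrite -(subrKA s) (le_trans (ler_normD _ _)) // mulr2n mulrDl mul1r.
rewrite lerD ?(ltW sd) // -{1}(ger0_norm s0) (le_trans (ler_dist_dist _ _)) //.
by rewrite distrC ltW.
Qed.

End Orthonormal.

(** * Eigenvectors of self-adjoint operators with compact resolvent *)

Section SelfAdjoint.
Context {R : realType} {H : hilbertType R} (A : regular H).
Implicit Types (x y u v w : H).

Lemma graph_linear (a : R[i]) x y u v : graph A (x, y) -> graph A (u, v) ->
  graph A (a *: x + u, a *: y + v).
Proof.
move=> [/= Dx ->] [/= Du ->]; split=> /=; last by rewrite regular_linear.
have [_ AD] := @dom_submod _ _ A.
have := AD a x u; rewrite ![_ \in mem _]/in_mem /=.
by rewrite !/(_ \in _) /= => /(_ (mem_set Dx) (mem_set Du)); rewrite inE.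
Qed.

Lemma graph00 : graph A (0, 0).
Proof.
have [D0 _] := @dom_submod _ _ A; have {}D0 : dom A 0 by rewrite inE in D0.
split=> //=; have := @regular_linear _ _ A (-1) 0 0 D0 D0.
by rewrite scaler0 addr0 scaleN1r addNr.
Qed.

Lemma graphZ (a : R[i]) x y : graph A (x, y) -> graph A (a *: x, a *: y).
Proof. by move=> /(graph_linear a)/(_ graph00); rewrite !addr0. Qed.

Lemma graphD x y u v : graph A (x, y) -> graph A (u, v) ->
  graph A (x + u, y + v).
Proof. by move=> /(graph_linear 1) h /h; rewrite !scale1r. Qed.

Lemma graph_fun x y y' : graph A (x, y) -> graph A (x, y') -> y = y'.
Proof.
move=> [_ yE] [_ y'E].
by rewrite -[y]/((x, y).2) yE -[y']/((x, y').2) y'E.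
Qed.

Hypothesis A_sa : self_adjoint A.

Lemma graph_sym x y u v : graph A (x, y) -> graph A (u, v) ->
  inner y u = inner x v.
Proof. by move=> xy; rewrite -A_sa => /(_ x y xy). Qed.

Variable T : bop H.
Hypothesis T_resolvent :
  fun_graph T = inv_graph (one_plus_graph (comp_graph (graph A) (graph A))).

(** The graph equation read as [(1 + A^2) T x = x], with [w] standing for [A T x]. *)
Lemma resolventP x : exists2 w, graph A (T x, w) & graph A (w, x - T x).
Proof.
have : fun_graph T (x, T x) by [].
by rewrite T_resolvent => -[w /= xw wx]; exists w.
Qed.

Lemma resolvent_eq x y w : graph A (y, w) -> graph A (w, x - y) -> T x = y.
Proof.
move=> yw wx; suff : fun_graph T (x, y) by exact: esym.
by rewrite T_resolvent; exists w.
Qed.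

(** Since [x = T x + A^2 T x] and likewise for [y], both sides equal
    [<T x, T y> + <A T x, A T y>]. *)
Lemma resolvent_sym x y : inner (T x) y = inner x (T y).
Proof.
have [w xw wx] := resolventP x; have [z yz zy] := resolventP y.
rewrite -{1}[y](subrK (T y)) -[in RHS](subrK (T x) x) ipDr ipDl; congr (_ + _).
by rewrite -(graph_sym xw zy) (graph_sym wx yz).
Qed.

Lemma resolvent_ge0 x : 0 <= inner (T x) x.
Proof.
have [w xw wx] := resolventP x.
rewrite -{2}[x](subrK (T x)) ipDr -(graph_sym xw wx).
by rewrite addr_ge0 // ip_ge0.
Qed.

Lemma resolvent_inj x : T x = 0 -> x = 0.
Proof.
have [w] := resolventP x => + + Tx; rewrite Tx subr0 => w0.
by rewrite (graph_fun w0 graph00) => /graph_fun/(_ graph00).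
Qed.

Lemma resolvent_eigen (l : R) v : graph A (v, l%:C%C *: v) ->
  T v = (1 + l ^+ 2)^-1%:C%C *: v.
Proof.
move=> vl; set t := (1 + l ^+ 2)^-1.
apply: (@resolvent_eq _ _ (t%:C%C *: (l%:C%C *: v))); first exact: graphZ.
have -> : v - t%:C%C *: v = (t * l)%:C%C *: (l%:C%C *: v).
  rewrite scalerA -rmorphM -{1}(scale1r v) -scalerBl -(rmorph1 (real_complex R))
    -rmorphB.
  congr (_%:C%C *: _).
  have : 1 + l ^+ 2 != 0 by rewrite gt_eqF // ltr_pwDl // sqr_ge0.
  by rewrite /t => h; field.
by rewrite scalerA -rmorphM; exact: graphZ.
Qed.

Hypothesis T_compact : compact_operator T.

Lemma rnorm_continuous (V : normedModType R[i]) :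
  continuous (fun x : V => complex.Re `|x|).
Proof.
move=> x; apply/cvgrPdist_lt => d d0.
have d0C : 0 < d%:C%C by rewrite (ltcR 0).
near=> y.
have : `|x - y| < d%:C%C by near: y; exact: cvgr_dist_lt.
move=> /(le_lt_trans (ler_dist_dist _ _)).
rewrite -[`|x|]RRe_real ?normr_real // -[`|y|]RRe_real ?normr_real // -rmorphB.
by rewrite normc_def /= expr0n addr0 sqrtr_sqr ltcR.
Unshelve. all: end_near. Qed.

(** The norm is maximized over the closure of the image of the unit ball of [M], which is compact in
    norm, so the maximum is attained without weak limits. Allowing a subspace [M] lets the result be
    applied to orthogonal complements. *)
Lemma resolvent_eigenvector (M : set H) x0 : closed M ->
    (forall a x y, M x -> M y -> M (a *: x + y)) ->
    (forall x, M x -> M (T x)) ->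
    M x0 -> x0 != 0 ->
  exists v (s : R[i]), [/\ M v, v != 0, 0 < s & T v = s *: v].
Proof.
move=> Mc Ml MT Mx0 x00.
have M0 : M 0 by have := Ml (-1) _ _ Mx0 Mx0; rewrite scaleN1r addNr.
have MZ a x : M x -> M (a *: x) by move=> Mx; rewrite -[_ *: _]addr0; exact: Ml.
pose B := [set x | M x /\ `|x| <= 1].
pose C := closure (T @` B).
have cC : compact C.
  move: T_compact; rewrite /compact_operator precompactE => /subclosed_compact.
  apply; first exact: closed_closure.
  by apply: closure_subset => _ [x [_ x1] <-]; exists x.
pose f (x : H) := complex.Re `|x|.
have fE x : `|x| = (f x)%:C%C by rewrite RRe_real // normr_real.
have C0 : C !=set0.
  exists (T 0); apply: subset_closure; exists 0 => //; split=> //.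
  by rewrite normr0.
have [|c Cc fc] := compact_EVT_max C0 cC (f := f).
  by apply: continuous_subspaceT; exact: rnorm_continuous.
have {}Cc : C c by rewrite inE in Cc.
have {}fc y : C y -> `|y| <= `|c|.
  by move=> Cy; rewrite !fE lecR; apply: fc; rewrite inE.
set s := `|c|.
have Ts x : M x -> `|T x| <= s * `|x|.
  move=> Mx; have [->|x_neq0] := eqVneq x 0; first by rewrite linear0 normr0
    mulr0.
  have nx : 0 < `|x| by rewrite normr_gt0.
  rewrite -ler_pdivrMr // mulrC -[X in X * _]ger0_norm ?invr_ge0 // -normrZ
    -linearZ /=.
  apply/fc/subset_closure; exists (`|x|^-1 *: x) => //; split; first exact: MZ.
  by rewrite normrZ normfV normr_id mulVf // gt_eqF.
have s_ge0 : 0 <= s by exact: normr_ge0.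
(* Otherwise [T] would vanish on [M], against its injectivity at [x0]. *)
have s0 : 0 < s.
  rewrite lt_neqAle normr_ge0 andbT; apply/eqP => s0.
  have := Ts _ Mx0; rewrite -s0 mul0r normr_le0 => /eqP/resolvent_inj.
  by move/eqP: x00.
have Mc' : M c.
  by apply: Mc; apply: closure_subset Cc => _ [x [Mx _] <-]; exact: MT.
(* For [x] in the unit ball, [|T x|^2 = <x, T T x> <= |T (T x)|]. This inequality is a closed
   condition on [T x], so it passes to [c]. *)
have sTc : s ^+ 2 <= `|T c|.
  suff : closed [set y | f y ^+ 2 <= f (T y)].
    move=> /closure_id cl; rewrite /s !fE -rmorphXn lecR.
    suff : [set y | f y ^+ 2 <= f (T y)] c by [].
    rewrite cl; apply: closure_subset Cc => _ [x [Mx x1] <-] /=.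
    rewrite -lecR rmorphXn /= -!fE -innerxx resolvent_sym.
    rewrite (le_trans (real_ler_norm _)) //.
      by rewrite -resolvent_sym ger0_real // ip_ge0.
    by rewrite (le_trans (cauchy_schwarz _ _)) // ler_piMl.
  have -> : [set y | f y ^+ 2 <= f (T y)] =
    (fun y => f (T y) - f y * f y) @^-1` [set r | 0 <= r].
    by apply/seteqP; split=> y /=; rewrite subr_ge0 expr2.
  apply: closed_comp; last exact: closed_ge.
  move=> y _; have fy : {for y, continuous f} by exact: rnorm_continuous.
  apply: (@cvgB R R^o H); last by apply: (@cvgM R).
  have := cvg_comp (T : H -> H) f (@bop_continuous _ _ T y)
    (@rnorm_continuous H (T y)); exact.
(* [c] maximizes the norm on the closure of [T B], so [s] bounds the norm of
   [T] on [M], and |T^2 c - s^2 c|^2 <= s^2 (s^4 - |T c|^2) <= 0. *)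
have TTc : T (T c) = s ^+ 2 *: c.
  apply/eqP; rewrite -subr_eq0 -normr_eq0 -sqrf_eq0 eq_le exprn_ge0 // andbT.
  have sR : (s ^+ 2)^* = s ^+ 2 by rewrite geC0_conj // exprn_ge0 // ltW.
  rewrite -innerxx ipBl !ipBr !ipZl !ipZr sR -(resolvent_sym c (T c)).
  rewrite (resolvent_sym (T c) c) !innerxx -/s.
  rewrite (_ : _ - _ = (`|T (T c)| ^+ 2 - s ^+ 2 * `|T c| ^+ 2) +
                       s ^+ 2 * (s ^+ 4 - `|T c| ^+ 2)); last by ring.
  rewrite -[leRHS]addr0 lerD // ?subr_le0.
    rewrite -exprMn ler_sqrC ?mulr_ge0 // Ts //; exact: MT.
  rewrite mulr_ge0_le0 ?exprn_ge0 // subr_le0 (_ : 4 = 2 * 2)%N // exprM.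
  by rewrite ler_sqrC ?exprn_ge0.
exists c, s; split=> //; first by rewrite -normr_gt0.
(* [T + s] kills [u], and is injective because [T] is positive. *)
apply/eqP; rewrite -subr_eq0; set u := T c - s *: c.
have Tu : T u = - s *: u.
  by rewrite /u linearB linearZ /= TTc scalerBr !scaleNr opprK scalerA addrC.
have := resolvent_ge0 u; rewrite Tu ipZl mulNr oppr_ge0 pmulr_rle0 // => u0.
by apply/eqP/ip_eq0/eqP; rewrite eq_le u0 ip_ge0.
Qed.

(** An eigenvector of [T] is one of [A^2], with a nonnegative eigenvalue [r^2]. The factorization
    [A^2 - r^2 = (A - r) (A + r)] then gives one of [A], inside [M] because [M] is stable under
    [A]. *)
Lemma sa_eigenvector (M : set H) x0 : closed M ->
    (forall a x y, M x -> M y -> M (a *: x + y)) ->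
    (forall x, M x -> M (T x)) ->
    (forall x y, M x -> graph A (x, y) -> M y) -> M x0 -> x0 != 0 ->
  exists v (l : R), [/\ M v, v != 0 & graph A (v, l%:C%C *: v)].
Proof.
move=> Mc Ml MT MA Mx0 x00.
have [c [s [Mc' c0 s0 Tc]]] := resolvent_eigenvector Mc Ml MT Mx0 x00.
have sn0 : s != 0 by rewrite gt_eqF.
have [w] := resolventP c; rewrite Tc => /(graphZ s^-1) cw /(graphZ s^-1) wc.
(* Dividing by [s] turns the resolvent relations into [A c = b] and [A b = k c], where
   [k = (1 - s) / s]. *)
move: cw wc; rewrite scalerA mulVf // scale1r; set b := s^-1 *: w => cb.
rewrite -{1}(scale1r c) -scalerBl scalerA; set k := s^-1 * _ => bk.
have k0 : 0 <= k.
  have : 0 <= k * inner c c by rewrite -ipZl (graph_sym bk cb) ip_ge0.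
  by rewrite pmulr_lge0 // innerxx exprn_gt0 // normr_gt0.
pose r := sqrtC k; have r0 : 0 <= r by rewrite sqrtC_ge0.
have rE : r = (complex.Re r)%:C%C by rewrite RRe_real // ger0_real.
(* [A c = b] and [A b = r^2 c], so [b + r c], unless it vanishes, is an
   eigenvector for [r]; otherwise [c] is one for [- r]. *)
have [b0|b0] := eqVneq b (- r *: c).
  exists c, (- complex.Re r); split=> //.
  by rewrite rmorphN /= -rE -b0.
exists (b + r *: c), (complex.Re r); split.
- by rewrite addrC; apply: Ml => //; exact: MA cb.
- by rewrite addr_eq0 -scaleNr.
- rewrite -rE scalerDr (scalerA r r) -expr2 sqrtCK addrC.
  rewrite [X in (_, X)]addrC addrC.
  by apply: graphD => //; exact: graphZ.
Qed.

Definition eigen_orthonormal (E : set H) :=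
  (forall v, E v -> inner v v = 1 /\ exists l : R, graph A (v, l%:C%C *: v)) /\
  (forall u v, E u -> E v -> u != v -> inner u v = 0).

(** The orthogonal complement [M] of a maximal orthonormal set of eigenvectors is closed and stable
    under [T] and [A]. If it were nonzero, it would contain a further eigenvector, which could be
    normalized and added. *)
Lemma eigenbasis_set : exists E : set H,
  eigen_orthonormal E /\ forall x, (forall v, E v -> inner x v = 0) -> x = 0.
Proof.
have [F FP Ftot|E [EP Emax]] := @Zorn_bigcup H eigen_orthonormal.
  split=> [v [X FX Xv]|u v [X FX Xu] [Y FY Yv]]; first by have [+ _] := FP _ FX;
    apply.
  have [XY|YX] := Ftot _ _ FX FY.
    by have [_] := FP _ FY; apply=> //; exact: XY.
  by have [_] := FP _ FX; apply=> //; exact: YX.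
exists E; split=> // x Ex; apply/eqP/negPn/negP => x0.
pose M := [set x | forall v, E v -> inner x v = 0].
have [Eeig Eort] := EP.
have [] := @sa_eigenvector M x _ _ _ _ Ex x0.
- have -> : M = \bigcap_(v in E) [set x | inner x v = 0] by [].
  by apply: closed_bigI => v _; exact: closed_ip_eq0.
- by move=> a y z My Mz v Ev; rewrite ipDl ipZl My // Mz // mulr0 addr0.
- move=> y My v Ev; have [_ [l /resolvent_eigen Tv]] := Eeig _ Ev.
  by rewrite resolvent_sym Tv ipZr My // mulr0.
- move=> y z My yz v Ev; have [_ [l lv]] := Eeig _ Ev.
  by rewrite (graph_sym yz lv) ipZr My // mulr0.
move=> v [l [Mv v0 vl]].
have nv : `|v| != 0 by rewrite normr_eq0.
pose u := `|v|^-1 *: v.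
have uu : inner u u = 1.
  by rewrite innerxx /u normrZ normfV normr_id mulVf // expr1n.
have Mu y : E y -> inner u y = 0 by move=> Ey; rewrite ipZl Mv // mulr0.
apply: (Emax (E `|` [set u])).
  split; first by move=> y Ey; left.
  move=> /(_ u (or_intror erefl)) /Mu; rewrite uu.
  by move/eqP; rewrite oner_eq0.
split.
  move=> y [Ey|->]; first exact: Eeig.
  split=> //; exists l; rewrite /u scalerA mulrC -scalerA; exact: graphZ.
move=> y z [Ey|->] [Ez|->] //.
- exact: Eort.
- by move=> _; rewrite ipC Mu // rmorph0.
- by move=> _; exact: Mu.
- by rewrite eqxx.
Qed.

End SelfAdjoint.

(** * Eigenbases *)

Lemma dense_dist {R : realType} (V : normedModType R[i]) (D : set V) (v : V) e :
  dense D -> 0 < e -> exists2 d, D d & `|v - d| < e.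
Proof.
move=> Dd e0; have [d [vd Dd']] := Dd _ (ex_intro _ v (ballxx v e0))
  (ball_open v _).
by exists d => //; have : ball v e d by []; rewrite -ball_normE.
Qed.

Lemma orthonormal_countable {R : realType} {H : hilbertType R} (D E : set H) :
  countable D -> dense D -> (forall v, E v -> inner v v = 1) ->
  (forall u v, E u -> E v -> u != v -> inner u v = 0) -> countable E.
Proof.
move=> /countable_injP[g gi] Dd E1 E0.
have half_gt0 : 0 < 2^-1 :> R[i] by rewrite invr_gt0.
(* Distinct vectors of [E] are at distance sqrt 2, hence have distinct points of
   [D] within 1/2. *)
have near v : exists d, D d /\ `|v - d| < 2^-1.
  have [d Dd' vd] := dense_dist v Dd half_gt0.
  by exists d.
have [d dP] := choice near.
apply/countable_injP; exists (g \o d) => u v; rewrite !inE => Eu Ev /= /gi duv.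
have {}duv : d u = d v by apply: duv; rewrite inE; case: (dP u); case: (dP v).
apply/eqP/negPn/negP => uv.
have uv1 : `|u - v| < 1.
  have [[_ ud] [_ vd]] := (dP u, dP v).
  rewrite -(subrKA (d u)) (le_lt_trans (ler_normD _ _)) // [ltRHS]splitr ltrD
    //.
    by rewrite mul1r.
  by rewrite mul1r duv distrC.
have : `|u - v| ^+ 2 < 1 by rewrite expr_lt1.
rewrite -innerxx ipBl !ipBr E1 // E1 // !E0 // 1?eq_sym //.
by rewrite subr0 sub0r opprK -ltrBrDl subrr ltr10.
Qed.

Lemma finite_dim_orthonormal {R : realType} {H : hilbertType R} (E : set H) :
  (forall v, E v -> inner v v = 1) ->
  (forall u v, E u -> E v -> u != v -> inner u v = 0) ->
  (forall x, (forall v, E v -> inner x v = 0) -> x = 0) ->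
  finite_set E -> finite_dim H.
Proof.
move=> E1 E0 Ecomplete /finite_seqP[s0 sE]; pose s := undup s0.
have {}sE v : E v <-> v \in s by rewrite sE /s mem_undup.
exists (size s), (fun i => nth 0 s i) => x.
exists (fun i => inner x (nth 0 s i)).
pose F v := inner x v *: v.
rewrite -(big_mkord xpredT (fun i => F (nth 0 s i))) -(big_nth 0 xpredT F).
apply/eqP; rewrite -subr_eq0; apply/eqP/Ecomplete => v Ev.
have vs : v \in s by apply/sE.
rewrite ipBl ip_suml (bigD1_seq v) ?undup_uniq //= ipZl E1 // mulr1.
rewrite big_seq_cond big1 ?addr0 ?subrr // => u /andP[us uv].
by rewrite ipZl (E0 u v) ?mulr0 //; exact/sE.
Qed.

Section Eigenbasis.
Context {R : realType} {H : hilbertType R} (A : regular H).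
Hypothesis A_sa : self_adjoint A.
Variable T : bop H.
Hypothesis T_resolvent :
  fun_graph T = inv_graph (one_plus_graph (comp_graph (graph A) (graph A))).
Hypothesis T_compact : compact_operator T.
Hypothesis H_separable : exists2 D : set H, countable D & dense D.
Hypothesis H_infinite_dim : ~ finite_dim H.

Lemma eigenbasis : exists (e : nat -> H) (l : nat -> R),
  [/\ forall i j, inner (e i) (e j) = (i == j)%:R,
      forall x, (forall n, inner x (e n) = 0) -> x = 0 &
      forall n, graph A (e n, (l n)%:C%C *: e n)].
Proof.
have [E [[Eeig E0] Ec]] := eigenbasis_set A_sa T_resolvent T_compact.
have E1 v : E v -> inner v v = 1 by case/Eeig.
have [D Dcount Dd] := H_separable.
have Ecount := orthonormal_countable Dcount Dd E1 E0.
have Einf : ~ finite_set E by move=> /(finite_dim_orthonormal E1 E0 Ec).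
have /card_esym/card_set_bijP[e [eE einj esurj]] := eq_card_nat Ecount Einf.
have {}eE n : E (e n) by exact: eE.
have [l lP] := choice (fun n => (Eeig _ (eE n)).2).
exists e, l; split=> // [i j|x xe].
  have [<-|ij] := eqVneq i j; first exact: E1.
  by rewrite E0 //; apply: contra_neq ij => /einj; apply; rewrite inE.
by apply: Ec => v /esurj[n _ <-].
Qed.

Variables (e : nat -> H) (l : nat -> R).
Hypothesis he : forall i j, inner (e i) (e j) = (i == j)%:R.
Hypothesis complete : forall x, (forall n, inner x (e n) = 0) -> x = 0.
Hypothesis Ae : forall n, graph A (e n, (l n)%:C%C *: e n).

Lemma eigenvalues_unbounded (N : R) :
  exists m, forall n, (m <= n)%N -> N < `|l n|.
Proof.
apply: contrapT => /forallNP noN.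
have small m : exists n, (m <= n)%N /\ `|l n| <= N.
  by have /existsNP[n /not_implyP[mn /negP]] := noN m; rewrite -leNgt; exists n.
have [f fP] := choice small.
(* A cluster point of [u] has zero coordinates, hence is 0, although the norms
   of the [u m] are bounded away from 0. *)
pose u m := T (e (f m)).
have ball1 n : `|e n| <= 1 by rewrite -(@ler_sqrC R) // -innerxx he eqxx expr1n.
have : compact (closure (T @` [set x : H | `|x| <= 1])).
  by move: T_compact; rewrite /compact_operator precompactE.
move=> /(_ (u @ \oo) _)[].
  by exists 0%N => // n _; apply: subset_closure; exists (e (f n)) => //=.
move=> y [_ yu].
have uE m : u m = (1 + l (f m) ^+ 2)^-1%:C%C *: e (f m).
  exact: (resolvent_eigen T_resolvent).
have y_near d m : 0 < d -> exists2 n, (m <= n)%N & `|y - u n| < d.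
  move=> d0; have um : (u @ \oo) (u @` [set n | (m <= n)%N]).
    by exists m => // n /= mn; exists n.
  have [_ [[n mn <-]]] := yu _ _ um (nbhsx_ballx y d d0).
  by rewrite -ball_normE; exists n.
have y0 : y = 0.
  apply: complete => k; apply/eqP; rewrite -normr_eq0; apply/eqP.
  apply: (@eq0_small _ _ 1) => // d /(y_near _ k.+1)[n kn yn].
  have uk : inner (u n) (e k) = 0.
    rewrite uE ipZl he gtn_eqF ?mulr0 //.
    by rewrite (leq_trans kn) //; case: (fP n).
  rewrite -[inner y _]subr0 -uk -ipBl (le_trans (cauchy_schwarz _ _)) // mul1r.
  by rewrite -[leRHS]mulr1 ler_pM // ltW.
(* The norm of [u n] is [1 / (1 + l (f n)^2)], hence at least [d]. *)
pose d := (1 + N ^+ 2)^-1.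
have d0 : 0 < d%:C%C by rewrite (ltcR 0) invr_gt0 ltr_pwDl // sqr_ge0.
have [n _] := y_near _ 0%N d0.
rewrite y0 sub0r normrN uE normrZ.
have -> : `|e (f n)| = 1.
  by apply/eqP; rewrite -sqrp_eq1 // -innerxx he eqxx.
have [_ lN] := fP n.
rewrite mulr1 ger0_norm; last by rewrite (lecR 0) invr_ge0 addr_ge0 // sqr_ge0.
rewrite ltcR; apply/negP; rewrite -leNgt lef_pV2 ?posrE ?ltr_pwDl ?sqr_ge0 //.
have N0 : 0 <= N by exact: le_trans lN.
by rewrite lerD2l -real_normK ?num_real // ler_pXn2r ?nnegrE.
Qed.

Lemma graph_coord x y n : graph A (x, y) ->
  inner y (e n) = (l n)%:C%C * inner x (e n).
Proof.
move=> xy; rewrite (graph_sym A_sa xy (Ae n)) ipZr.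
by congr (_ * _); apply/CrealP; rewrite complex_real.
Qed.

Lemma resolvent_coord x n :
  inner (T x) (e n) = (1 + l n ^+ 2)^-1%:C%C * inner x (e n).
Proof.
rewrite (resolvent_sym A_sa T_resolvent) (resolvent_eigen T_resolvent (Ae n))
  ipZr.
by congr (_ * _); apply/CrealP; rewrite complex_real.
Qed.

(** The eigenbasis determines the domain of [A] too: a pair satisfying the coordinate equations is
    rebuilt as a sum of two pairs obtained from the resolvent, which lie in the graph. *)
Lemma graph_coordP x y :
  graph A (x, y) <-> forall n, inner y (e n) = (l n)%:C%C * inner x (e n).
Proof.
split=> [xy n|xy]; first exact: graph_coord.
have [w xw wx] := resolventP T_resolvent x.
have [z yz zy] := resolventP T_resolvent y.
have g := graphD xw zy.
(* Here [z = A T y], and [x = T x + A T y] whenever [y = A x]. *)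
have xE : T x + z = x.
  apply: (coord_ext complete) => n.
  rewrite ipDl (graph_coord n yz) !resolvent_coord xy !mulrA -!rmorphM -mulrDl.
  rewrite -rmorphD -[RHS]mul1r -(rmorph1 (real_complex R)).
  congr (_%:C%C * _).
  have : 1 + l n ^+ 2 != 0 by rewrite gt_eqF // ltr_pwDl // sqr_ge0.
  by move=> h; field.
have yE : w + (y - T y) = y.
  apply: (coord_ext complete) => n.
  by rewrite (graph_coord n g) xE xy.
by rewrite xE yE in g.
Qed.

End Eigenbasis.

(** * Diagonal operators *)

Section Diagonal.
Context {R : realType} {H : hilbertType R} (e : nat -> H).
Hypothesis he : forall i j, inner (e i) (e j) = (i == j)%:R.
Hypothesis complete : forall x, (forall n, inner x (e n) = 0) -> x = 0.
Implicit Types (x y : H) (z w : hsum H) (a mu : nat -> R).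

Definition diagonal_op a (f : H -> H) :=
  forall x n, inner (f x) (e n) = (a n)%:C%C * inner x (e n).

Lemma normCr (r : R) : `|r%:C%C| = `|r|%:C%C :> R[i].
Proof. by rewrite normc_def /= expr0n addr0 sqrtr_sqr. Qed.

Lemma conjCr (r : R) : (r%:C%C)^* = r%:C%C.
Proof. by apply/CrealP; rewrite complex_real. Qed.

Lemma diagonal_bop a (C : R) : (forall n, `|a n| <= C) ->
  exists D : bop H, diagonal_op a D.
Proof.
move=> aC; have C0 : 0 <= C%:C%C.
  by rewrite (lecR 0) (le_trans _ (aC 0%N)).
have aC' n : `|(a n)%:C%C| <= C%:C%C by rewrite normCr lecR.
have [f fP] := choice (fun x => coord_exists he x C0 aC').
have fl : linear f.
  move=> b x y; apply: (coord_ext complete) => n.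
  by rewrite fP !ipDl !ipZl !fP; ring.
have fC x : `|f x| <= C%:C%C * `|x|.
  by apply: (coord_norm he complete) => // n; rewrite fP normrM ler_wpM2r.
by exists (Bop fl (bounded_op_continuous fl fC)) => x n; exact: fP.
Qed.

(** The sign condition concerns only the coordinates present in [x], so it can be used on the
    subspace where the first [m] coordinates vanish. *)
Lemma diagonal_ge0 a (f : H -> H) x : diagonal_op a f ->
    (forall n, inner x (e n) != 0 -> 0 <= a n) ->
  0 <= inner (f x) x.
Proof.
move=> fa a0; apply: (ip_coord_ge0 he complete) => n; rewrite fa -mulrA -normCK.
have [->|/a0 an] := eqVneq (inner x (e n)) 0; first by rewrite normr0 expr0n
  mulr0.
by rewrite mulr_ge0 ?exprn_ge0 // (lecR 0).
Qed.

Lemma diagonal_eigen a (f : H -> H) n : diagonal_op a f ->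
  f (e n) = (a n)%:C%C *: e n.
Proof.
move=> fa; apply: (coord_ext complete) => k; rewrite fa ipZl he.
by case: eqP => [->//|]; rewrite !mulr0.
Qed.

(** The diagonal operator on its maximal domain: the existence of [z.2] stands for square
    summability of the products [mu n * <z.1, e n>]. *)
Definition diagonal_graph mu : set (hsum H) :=
  [set z | forall n, inner z.2 (e n) = (mu n)%:C%C * inner z.1 (e n)].

Lemma diagonal_graph_eigen mu n : diagonal_graph mu (e n, (mu n)%:C%C *: e n).
Proof.
move=> k /=; rewrite ipZl he.
by case: eqP => [->//|]; rewrite !mulr0.
Qed.

Lemma diagonal_graph_linear mu c z w : diagonal_graph mu z ->
  diagonal_graph mu w -> diagonal_graph mu (c *: z + w).
Proof. by move=> zG wG n /=; rewrite !ipDl !ipZl zG wG; ring. Qed.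

Lemma diagonal_graph_fun mu x y y' :
  diagonal_graph mu (x, y) -> diagonal_graph mu (x, y') -> y = y'.
Proof. by move=> yP y'P; apply: (coord_ext complete) => n; rewrite yP y'P. Qed.

(** Testing the adjoint relation on the eigenvectors yields the coordinate equations; conversely, as
    [mu] is real, the two expansions agree term by term. *)
Lemma adj_diagonal_graph mu : adj_graph (diagonal_graph mu) = diagonal_graph mu.
Proof.
apply/seteqP; split=> z zG.
  move=> n; have := zG _ _ (diagonal_graph_eigen mu n).
  rewrite ipZl ipC [in RHS]ipC => /(congr1 (@Num.conj R[i])).
  by rewrite rmorphM /= !conjCK conjCr => ->.
move=> x y xy; apply: (ip_ext he complete) => n.
by rewrite xy zG rmorphM /= conjCr; ring.
Qed.

Lemma closed_diagonal_graph mu : closed (diagonal_graph mu).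
Proof.
(* The graph is the orthogonal complement of the vectors [(- mu n e_n, e_n)]. *)
have -> : diagonal_graph mu = \bigcap_(n in setT)
    [set z : hsum H | inner z (- (mu n)%:C%C *: e n, e n) = 0].
  apply/seteqP; split=> z zG n.
    by move=> _; rewrite /= /inner /= /hsum_inner /= ipZr rmorphN /= conjCr zG;
      ring.
  have := zG n Logic.I; rewrite /= /inner /= /hsum_inner /= ipZr rmorphN /=
    conjCr.
  by move=> /eqP; rewrite mulNr addrC subr_eq0 => /eqP.
by apply: closed_bigI => n _; exact: closed_ip_eq0.
Qed.

(** * The regular operator with prescribed eigenvalues *)

Section DiagonalRegular.
Variable mu : nat -> R.

Let ddom := [set x | exists y, diagonal_graph mu (x, y)].
(** The default 0 is the value that [regular_out] requires outside the domain. *)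
Let dfun x := xget 0 [set y | diagonal_graph mu (x, y)].

Let dfunP x y : diagonal_graph mu (x, y) <-> ddom x /\ y = dfun x.
Proof.
split=> [xy|[[y' xy'] ->]]; last exact:
  (@xgetPex _ 0 [set y | diagonal_graph mu (x, y)]) (ex_intro _ y' xy').
split; first by exists y.
apply: (diagonal_graph_fun xy).
exact: (@xgetPex _ 0 [set y | diagonal_graph mu (x, y)]) (ex_intro _ y xy).
Qed.

Let ddom_submod : submod_closed (mem ddom).
Proof.
split=> [|c x y].
  by rewrite inE; exists 0 => n /=; rewrite !ip0l mulr0.
rewrite !inE => -[x' xx'] [y' yy']; exists (c *: x' + y').
exact: (diagonal_graph_linear c xx' yy').
Qed.

Let ddom_dense : dense ddom.
Proof.
move=> O [x Ox] oO.
have [d d0 dO] : exists2 d : R[i], 0 < d & ball x d `<=` O.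
  by apply/nbhs_ballP; exact: open_nbhs_nbhs.
(* The partial sums of [x] converge to [x], and as finite combinations of eigenvectors they lie in
   the domain. *)
have [y [yx _ yN]] := riesz_fischer he (normr_ge0 x) (bessel he x).
have yE : y = x by apply: (coord_ext complete).
rewrite yE in yN; have [N /(_ N (leqnn N)) Nd] := yN _ d0.
exists (partial_sum e (fun i => inner x (e i)) N); split.
  by apply: dO; rewrite -ball_normE.
exists (partial_sum e (fun i => (mu i)%:C%C * inner x (e i)) N) => n /=.
rewrite !ip_sum_orthonormal ?iota_uniq //.
by case: ifP => _ //; rewrite mulr0.
Qed.

Let dfun_linear c x y : ddom x -> ddom y ->
  dfun (c *: x + y) = c *: dfun x + dfun y.
Proof.
move=> Dx Dy; apply/esym.
have xx : diagonal_graph mu (x, dfun x) by apply/dfunP.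
have yy : diagonal_graph mu (y, dfun y) by apply/dfunP.
by have /dfunP[] := diagonal_graph_linear c xx yy.
Qed.

Let dfun_out x : ~ ddom x -> dfun x = 0.
Proof. by move=> Dx; apply: xgetPN => y xy; apply: Dx; exists y. Qed.

Let dfun_closed : closed [set z : hsum H | ddom z.1 /\ z.2 = dfun z.1].
Proof.
have -> : [set z : hsum H | ddom z.1 /\ z.2 = dfun z.1] = diagonal_graph mu.
  by apply/seteqP; split=> -[x y] /dfunP.
exact: closed_diagonal_graph.
Qed.

Lemma diagonal_regular : exists B : regular H, graph B = diagonal_graph mu.
Proof.
exists (Regular ddom_submod ddom_dense dfun_linear dfun_out dfun_closed).
by apply/seteqP; split=> -[x y] /dfunP.
Qed.

End DiagonalRegular.
End Diagonal.

Lemma fun_graphE {R : realType} {H : hilbertType R} (f : H -> H) x y :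
  fun_graph f (x, y) = (y = f x).
Proof. by []. Qed.

(** * Bounded transform, essential signs and graph projection of a diagonal operator *)

Section DiagonalOperator.
Context {R : realType} {H : hilbertType R} (e : nat -> H).
Hypothesis he : forall i j, inner (e i) (e j) = (i == j)%:R.
Hypothesis complete : forall x, (forall n, inner x (e n) = 0) -> x = 0.
Variables (mu : nat -> R) (B : regular H).
Hypothesis graphB : graph B = diagonal_graph e mu.
Implicit Types (x y : H) (z w : hsum H).

(** The eigenvalue of [(1 + B^2)^-1] at [e n]; those of [B (1 + B^2)^-1] and of the bounded
    transform are [mu n * t n] and [mu n * Num.sqrt (t n)]. *)
Let t n := (1 + mu n ^+ 2)^-1.

Let mu1_gt0 n : 0 < 1 + mu n ^+ 2.
Proof. by rewrite ltr_pwDl // sqr_ge0. Qed.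

Let t_gt0 n : 0 < t n. Proof. by rewrite invr_gt0. Qed.

Let t_le1 n : `|t n| <= 1.
Proof. by rewrite gtr0_norm // invf_le1 // lerDl sqr_ge0. Qed.

Let mut_le1 n : `|mu n * t n| <= 1.
Proof.
rewrite normrM (gtr0_norm (t_gt0 n)) ler_pdivrMr // mul1r.
rewrite -[X in _ <= _ + X]real_normK ?num_real //.
by have := sqr_ge0 (`|mu n| - 1); have := normr_ge0 (mu n); nra.
Qed.

Lemma diagonal_self_adjoint : self_adjoint B.
Proof. by rewrite /self_adjoint graphB adj_diagonal_graph. Qed.

Lemma diagonal_resolvent_graph (T : H -> H) : diagonal_op e t T ->
  fun_graph T = inv_graph (one_plus_graph (comp_graph (graph B) (graph B))).
Proof.
(* [K] is [B T]; it provides the intermediate vector of the composite graph. *)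
move=> Tt; have [K Kmu] := diagonal_bop he complete mut_le1.
rewrite graphB; apply/seteqP; split=> -[x y] /=.
  rewrite /fun_graph /= => ->; exists (K x) => n /=.
    by rewrite Kmu Tt rmorphM mulrA.
  rewrite ipBl Kmu Tt -{1}[inner x _]mul1r -mulrBl mulrA.
  rewrite -(rmorph1 (real_complex R)) -rmorphB -rmorphM.
  congr (_%:C%C * _); rewrite /t.
  by have h := gt_eqF (mu1_gt0 n); field; rewrite h.
move=> [w /= yw wx]; apply: (coord_ext complete) => n.
have := wx n; rewrite /= yw ipBl => /eqP; rewrite subr_eq => /eqP xE.
rewrite Tt xE mulrA -[X in _ = _ * (_ + X)]mul1r.
rewrite -rmorphM -(rmorph1 (real_complex R)) -mulrDl -rmorphD mulrA -rmorphM.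
rewrite -[LHS]mul1r -(rmorph1 (real_complex R)).
congr (_%:C%C * _); rewrite /t.
by have h := gt_eqF (mu1_gt0 n); field; rewrite h.
Qed.

Lemma diagonal_bounded_transform_exists : exists F : bop H,
  bounded_transform B F /\ diagonal_op e (fun n => mu n * Num.sqrt (t n)) F.
Proof.
have st_le1 n : `|Num.sqrt (t n)| <= 1.
  by rewrite ger0_norm ?sqrtr_ge0 // -sqrtr1 ler_sqrt // -[leLHS]gtr0_norm.
have must_le1 n : `|mu n * Num.sqrt (t n)| <= 1.
  rewrite -(@expr_le1 _ 2) // real_normK ?num_real // exprMn sqr_sqrtr ?ltW //.
  by rewrite /t ltr_pdivrMr // mul1r ltrDr ltr01.
have [S Sst] := diagonal_bop he complete st_le1.
have [F Fmu] := diagonal_bop he complete must_le1.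
exists F; split=> //; exists S; split.
- by move=> x; apply: (diagonal_ge0 he complete Sst) => n _; exact: sqrtr_ge0.
- rewrite diagonal_self_adjoint; apply: diagonal_resolvent_graph => x n.
  by rewrite /= !Sst mulrA -rmorphM -expr2 sqr_sqrtr // ltW.
- rewrite graphB; apply/seteqP; split=> -[x y] /=.
    rewrite /fun_graph /= => ->; exists (S x) => // n /=.
    by rewrite Fmu Sst rmorphM mulrA.
  move=> [w]; rewrite fun_graphE => -> wy; apply: (coord_ext complete) => n.
  by rewrite Fmu (wy n) /= Sst rmorphM mulrA.
Qed.

(** Showing that [B] is not essentially of one sign means refuting every bounded transform [F],
    whose root [S] is not known to be diagonal. Its values on the basis are all that is required. *)
Lemma bounded_transform_eigen (F : bop H) n : bounded_transform B F ->
  F (e n) = (mu n * Num.sqrt (t n))%:C%C *: e n.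
Proof.
move=> [S [S0]]; rewrite diagonal_self_adjoint => SS FS.
have [T Tt] := diagonal_bop he complete t_le1.
have SST x : S (S x) = T x.
  have : fun_graph T (x, T x) by [].
  by rewrite (diagonal_resolvent_graph Tt) -SS.
pose s := Num.sqrt (t n).
have s0 : 0 < s by rewrite sqrtr_gt0.
(* [S + s] kills [u := S e_n - s e_n], and is injective because [S] is
   positive: positive square roots are unique on eigenvectors. *)
have Se : S (e n) = s%:C%C *: e n.
  apply/eqP; rewrite -subr_eq0; set u := S (e n) - _.
  have Su : S u = - s%:C%C *: u.
    rewrite /u linearB linearZ /= SST (diagonal_eigen he complete n Tt).
    rewrite scalerBr !scaleNr opprK scalerA -rmorphM -expr2 sqr_sqrtr ?ltW //.
    by rewrite addrC.
  have := S0 u; rewrite Su ipZl mulNr oppr_ge0 pmulr_rle0 ?(ltcR 0) // => u0.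
  by apply/eqP/ip_eq0/eqP; rewrite eq_le u0 ip_ge0.
have : fun_graph F (e n, F (e n)) by [].
rewrite FS => -[w]; rewrite fun_graphE => ->; rewrite Se graphB => wF.
apply: (diagonal_graph_fun complete wF).
rewrite rmorphM mulrC -scalerA => k /=.
by rewrite !ipZl [RHS]mulrCA -(ipZl (mu n)%:C%C); congr (_ * _); exact:
  diagonal_graph_eigen.
Qed.

Lemma finite_codim_kernel m : finite_codim
  [set x | forall n, (n < m)%N -> inner x (e n) = 0].
Proof.
exists m, (fun i => e i) => x; exists (fun i => inner x (e i)) => n nm.
rewrite -(big_mkord xpredT (fun i => inner x (e i) *: e i)) ipBl.
by rewrite ip_sum_orthonormal ?iota_uniq // mem_index_iota nm subrr.
Qed.

Lemma submod_kernel m :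
  submod_closed (mem [set x | forall n, (n < m)%N -> inner x (e n) = 0]).
Proof.
split=> [|c x y]; first by rewrite inE => n _; rewrite ip0l.
by rewrite !inE => x0 y0 n nm; rewrite ipDl ipZl x0 // y0 // mulr0 addr0.
Qed.

Lemma diagonal_ess_positive m : (forall n, (m <= n)%N -> 0 <= mu n) ->
  exists2 F, bounded_transform B F & ess_positive F.
Proof.
move=> mu0; have [F [BF Fmu]] := diagonal_bounded_transform_exists.
exists F => //; exists [set x | forall n, (n < m)%N -> inner x (e n) = 0].
split; [exact: submod_kernel|exact: finite_codim_kernel| |].
  by move=> _ [x x0 <-] n nm; rewrite Fmu x0 // mulr0.
move=> x x0; apply: (diagonal_ge0 he complete Fmu) => n xn.
rewrite mulr_ge0 ?sqrtr_ge0 // mu0 // leqNgt; apply/negP => /x0.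
by apply/eqP.
Qed.

Lemma diagonal_ess_negative m : (forall n, (m <= n)%N -> mu n <= 0) ->
  exists2 F, bounded_transform B F & ess_negative F.
Proof.
move=> mu0; have [F [BF Fmu]] := diagonal_bounded_transform_exists.
exists F => //; exists [set x | forall n, (n < m)%N -> inner x (e n) = 0].
split; [exact: submod_kernel|exact: finite_codim_kernel| |].
  by move=> _ [x x0 <-] n nm; rewrite Fmu x0 // mulr0.
(* The positivity criterion is applied to [- F]. *)
move=> x x0; rewrite -oppr_ge0 -mulN1r -ipZl.
apply: (@diagonal_ge0 _ _ _ he complete (fun n => - (mu n * Num.sqrt (t n)))
  (fun x => -1 *: F x)).
  by move=> y n; rewrite ipZl Fmu mulN1r rmorphN mulNr.
move=> n xn; rewrite oppr_ge0 mulr_le0_ge0 ?sqrtr_ge0 // mu0 // leqNgt.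
by apply/negP => /x0; apply/eqP.
Qed.

(** Modulo [W], every vector is a combination of [n] fixed ones, so [n + 1] basis vectors satisfy a
    nontrivial linear relation modulo [W]. *)
Lemma finite_codim_meet (W : set H) (f : nat -> nat) :
    submod_closed (mem W) -> finite_codim W ->
  exists k (d : 'I_k -> R[i]), (exists i, d i != 0) /\
    W (\sum_(i < k) d i *: e (f i)).
Proof.
move=> [W0 Wl] [n [v vP]].
have [c cP] := choice (fun i => vP (e (f i))).
pose C : 'M[R[i]]_(n.+1, n) := \matrix_(i, j) c i j.
have : kermx C != 0.
  rewrite -mxrank_eq0 mxrank_ker subn_eq0 -ltnNge ltnS rank_leq_col.
  by [].
move=> /rowV0Pn[d dC d0]; exists n.+1, (fun i => d 0 i); split.
  apply/existsP; apply: contraNT d0; rewrite negb_exists => /forallP d0.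
  by apply/eqP/rowP => i; rewrite mxE; apply/eqP/negPn/d0.
have dE : \sum_(i < n.+1) d 0 i *: (\sum_(j < n) c i j *: v j) = 0.
  under eq_bigr do rewrite scaler_sumr.
  rewrite exchange_big big1 //= => j _.
  under eq_bigr do rewrite scalerA.
  rewrite -scaler_suml; move: dC => /sub_kermxP/matrixP/(_ 0 j).
  by rewrite !mxE; under eq_bigr do rewrite mxE; move=> ->; rewrite scale0r.
(* The relation [d] cancels the corrections by the [v j], leaving a combination of elements of
   [W]. *)
have -> : \sum_(i < n.+1) d 0 i *: e (f i) =
    \sum_(i < n.+1) d 0 i *: (e (f i) - \sum_(j < n) c i j *: v j).
  by under [RHS]eq_bigr do rewrite scalerBr; rewrite sumrB dE subr0.
have {}Wl a x y : W x -> W y -> W (a *: x + y).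
  by move=> Wx Wy; have := Wl a x y; rewrite !inE; apply.
have {}W0 : W 0 by rewrite inE in W0.
elim/big_rec: _ => // i x _ Wx; exact: Wl.
Qed.

Lemma bounded_transform_quadratic (F : bop H) (f : nat -> nat) k
  (d : 'I_k -> R[i]) :
  injective f -> bounded_transform B F ->
  let x := \sum_(i < k) d i *: e (f i) in
  inner (F x) x =
    \sum_(i < k) (mu (f i) * Num.sqrt (t (f i)))%:C%C * `|d i| ^+ 2.
Proof.
move=> fi BF x.
have -> : F x = \sum_(i < k) F (d i *: e (f i)) by rewrite /x linear_sum.
rewrite ip_suml; apply: eq_bigr => i _.
rewrite linearZ /= (bounded_transform_eigen _ BF) !ipZl ip_sumr (bigD1 i) //=.
rewrite big1 ?addr0 => [|j ji].
  by rewrite ipZr he eqxx mulr1 normCK; ring.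
by rewrite ipZr he (inj_eq fi) (inj_eq val_inj) eq_sym (negPf ji) mulr0.
Qed.

(** Any [W] of finite codimension contains a nonzero combination of eigenvectors with negative
    eigenvalues, on which the quadratic form of [F] is negative. *)
Lemma not_ess_positive (F : bop H) (f : nat -> nat) : injective f ->
  (forall i, mu (f i) < 0) -> bounded_transform B F -> ~ ess_positive F.
Proof.
move=> fi fmu BF [W [Ws Wc _ WF]].
have [k [d [[i0 d0] Wd]]] := finite_codim_meet f Ws Wc.
have := WF _ Wd; apply/negP; rewrite bounded_transform_quadratic //.
have neg i : (mu (f i) * Num.sqrt (t (f i)))%:C%C < 0 :> R[i].
  by rewrite (ltcR _ 0) nmulr_rlt0 // sqrtr_gt0.
suff : \sum_(i < k) (mu (f i) * Num.sqrt (t (f i)))%:C%C * `|d i| ^+ 2 < 0.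
  by move=> s0; rewrite lt_geF.
rewrite (bigD1 i0) //= -[ltRHS]addr0 ltr_leD //.
  by rewrite nmulr_rlt0 // exprn_gt0 // normr_gt0.
by apply: sumr_le0 => i _; rewrite mulr_le0_ge0 ?exprn_ge0 // ltW.
Qed.

Lemma not_ess_negative (F : bop H) (f : nat -> nat) : injective f ->
  (forall i, 0 < mu (f i)) -> bounded_transform B F -> ~ ess_negative F.
Proof.
move=> fi fmu BF [W [Ws Wc _ WF]].
have [k [d [[i0 d0] Wd]]] := finite_codim_meet f Ws Wc.
have := WF _ Wd; apply/negP; rewrite bounded_transform_quadratic //.
have pos i : 0 < (mu (f i) * Num.sqrt (t (f i)))%:C%C :> R[i].
  by rewrite (ltcR 0) mulr_gt0 // sqrtr_gt0.
suff : 0 < \sum_(i < k) (mu (f i) * Num.sqrt (t (f i)))%:C%C * `|d i| ^+ 2.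
  by move=> s0; rewrite lt_geF.
rewrite (bigD1 i0) //= -[ltLHS]addr0 ltr_leD //.
  by rewrite mulr_gt0 // exprn_gt0 // normr_gt0.
by apply: sumr_ge0 => i _; rewrite mulr_ge0 ?exprn_ge0 // ltW.
Qed.

(** [graph_projection] is chosen by [get], so its specification holds once some bounded projection
    is exhibited. *)
Lemma graph_projectionP : orthogonal_projection (graph B) (graph_projection B).
Proof.
apply: getPex; have [T Tt] := diagonal_bop he complete t_le1.
have [K Kmu] := diagonal_bop he complete mut_le1.
(* With [T = (1 + B^2)^-1] and [K = B T], the projection onto the graph of [B]
   is the block matrix [[T, K], [K, 1 - T]]. *)
pose p z : hsum H := (T z.1 + K z.2, K z.1 + (z.2 - T z.2)).
have mu_t n : (mu n)%:C%C * (mu n * t n)%:C%C = 1 - (t n)%:C%C :> R[i].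
  rewrite -(rmorph1 (real_complex R)) -rmorphB -rmorphM; congr (_%:C%C).
  by rewrite /t; have h := gt_eqF (mu1_gt0 n); field; rewrite h.
have pG z : graph B (p z).
  rewrite graphB => n /=; rewrite !(ipDl, ipNl) !Tt !Kmu mulrDr
    (mulrA _ _ (inner z.2 _)) mu_t.
  by rewrite !rmorphM /=; ring.
have pO z w : graph B w -> inner (z - p z) w = 0.
  rewrite graphB => wG; rewrite /inner /= /hsum_inner /=.
  have -> : inner (z.1 - (T z.1 + K z.2)) w.1 = inner (K z.1 - T z.2) w.2.
    apply: (ip_ext he complete) => n; rewrite wG rmorphM /= conjCr mulrCA mulrA.
    congr (_ * _); rewrite !ipBl ipDl !Tt !Kmu mulrBr mulrA mu_t.
    by rewrite rmorphM /=; ring.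
  have -> : z.2 - (K z.1 + (z.2 - T z.2)) = - (K z.1 - T z.2).
    by rewrite opprB opprD opprB addrCA subrKC addrC.
  by rewrite ipNl addrN.
have pl : linear p.
  move=> a z w; rewrite /p /=; congr pair; apply: (coord_ext complete) => n /=;
  by rewrite !(ipDl, ipNl, ipZl, Tt, Kmu) /=; ring.
have pC z : `|p z| <= 1 * `|z|.
  rewrite mul1r -ler_sqrC // -[X in _ <= `|X| ^+ 2](subrK (p z)).
  by rewrite pythagoras ?lerDr ?exprn_ge0 // pO.
exists (Bop pl (bounded_op_continuous pl pC)) => z; split=> // w; exact: pO.
Qed.

(** Orthogonality of [z - p] to the graph vector [(e n, mu n e n)], together with membership of [p]
    in the graph, determines both coordinates. *)
Lemma graph_projection_coord z n (p := graph_projection B z) :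
  inner p.1 (e n) = (t n)%:C%C *
    (inner z.1 (e n) + (mu n)%:C%C * inner z.2 (e n)) /\
  inner p.2 (e n) = (mu n)%:C%C * inner p.1 (e n).
Proof.
have [pG pO] := graph_projectionP z; rewrite graphB in pG pO.
split; last exact: pG.
have := pO _ (diagonal_graph_eigen he mu n); rewrite /inner /= /hsum_inner /=.
rewrite ipZr conjCr !ipBl (pG n) -/p => h.
have h1 : (t n)%:C%C * (1 + (mu n)%:C%C ^+ 2) = 1 :> R[i].
  rewrite -(rmorph1 (real_complex R)) -rmorphXn -rmorphD -rmorphM.
  by congr (_%:C%C); rewrite mulVf // gt_eqF.
rewrite -[LHS]mul1r -h1 -mulrA; congr (_ * _).
by apply/eqP; rewrite eq_sym -subr_eq0 -h; apply/eqP; ring.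
Qed.

End DiagonalOperator.

(** * Changing signs of eigenvalues *)

Lemma mdist_bop_le {R : realType} {E : hilbertType R} (P Q : bop E) (d : R) :
  (forall z, `|P z - Q z| <= d%:C%C * `|z|) -> 0 <= d -> mdist P Q <= d.
Proof.
move=> PQ d0; apply: ge_sup.
  by exists (complex.Re `|P 0 - Q 0|), 0 => //=; rewrite normr0.
move=> _ [z z1 <-]; rewrite -lecR RRe_real ?normr_real //.
by rewrite (le_trans (PQ z)) // ler_piMr // (lecR 0).
Qed.

Lemma hsum_norm_sqr {R : realType} {H : hilbertType R} (z : hsum H) :
  `|z| ^+ 2 = `|z.1| ^+ 2 + `|z.2| ^+ 2.
Proof. by rewrite -!innerxx. Qed.

Section Perturbation.
Context {R : realType} {H : hilbertType R}.
Hypothesis H_separable : exists2 D : set H, countable D & dense D.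
Hypothesis H_infinite_dim : ~ finite_dim H.

(** As the squares agree, the diagonal blocks cancel: the first component of the difference depends
    on [z.2] alone and the second on [z.1] alone, each through the factor
    [(l n - mu n) / (1 + l n^2)]. *)
Lemma graph_projection_dist (e : nat -> H) (A B : regular H) (l mu : nat -> R)
  (d : R) :
    (forall i j, inner (e i) (e j) = (i == j)%:R) ->
    (forall x, (forall n, inner x (e n) = 0) -> x = 0) ->
    graph A = diagonal_graph e l -> graph B = diagonal_graph e mu ->
    (forall n, mu n ^+ 2 = l n ^+ 2) -> 0 <= d ->
    (forall n, `|l n - mu n| / (1 + l n ^+ 2) <= d) ->
  mdist (graph_projection A) (graph_projection B) <= d.
Proof.
move=> he complete Al Bmu lmu d0 ld; apply: mdist_bop_le => // z.
have dC0 : 0 <= d%:C%C :> R[i] by rewrite (lecR 0).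
have PA n := graph_projection_coord he complete Al z n.
have PB n := graph_projection_coord he complete Bmu z n.
move: PA PB; set p := graph_projection A z; set q := graph_projection B z => PA
  PB.
(* The right-hand sum is swapped to pair each component with the one it depends on. *)
rewrite -ler_sqrC ?mulr_ge0 // exprMn !hsum_norm_sqr /= mulrDr [leRHS]addrC.
have ldC n : `|(1 + l n ^+ 2)^-1%:C%C * (l n - mu n)%:C%C| <= d%:C%C :> R[i].
  rewrite -rmorphM normCr lecR normrM mulrC [X in _ * X]ger0_norm //.
  by rewrite invr_ge0 addr_ge0 // sqr_ge0.
have scale (u v : H) : (forall n, inner u (e n) =
      (1 + l n ^+ 2)^-1%:C%C * (l n - mu n)%:C%C * inner v (e n)) ->
    `|u| ^+ 2 <= d%:C%C ^+ 2 * `|v| ^+ 2.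
  move=> uv; rewrite -exprMn ler_sqrC ?mulr_ge0 //.
  by apply: (coord_norm he complete) => // n; rewrite uv normrM ler_wpM2r.
apply: lerD; apply: scale => n; rewrite ipBl.
  by rewrite (PA n).1 (PB n).1 lmu rmorphB /=; ring.
rewrite (PA n).2 (PA n).1 (PB n).2 (PB n).1 lmu rmorphB /=.
have lmuC : (mu n)%:C%C ^+ 2 = (l n)%:C%C ^+ 2 :> R[i] by rewrite -!rmorphXn
  lmu.
set t := _^-1%:C%C.
rewrite (_ : _ - _ = t * ((l n)%:C%C - (mu n)%:C%C) * inner z.1 (e n) +
  t * ((l n)%:C%C ^+ 2 - (mu n)%:C%C ^+ 2) * inner z.2 (e n)); last by ring.
by rewrite lmuC subrr mulr0 mul0r addr0.
Qed.

(** [sg n = true] asks for a negative eigenvalue; the prescription is obeyed from index [m] on, the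
    earlier eigenvalues being left as they are. *)
Lemma perturbation (A : RKsa H) (O : set (RKsa H)) (sg : nat -> bool) :
  open O -> O A -> exists (e : nat -> H) (mu : nat -> R) (B : RKsa H) m,
  [/\ forall i j, inner (e i) (e j) = (i == j)%:R,
      forall x, (forall n, inner x (e n) = 0) -> x = 0,
      O B, graph B = diagonal_graph e mu &
      forall n, (m <= n)%N -> 0 < (-1) ^+ sg n * mu n].
Proof.
move=> [U oU <-] /= UA.
have A_sa := RKsa_self_adjoint A.
have [T T_res T_comp] := RKsa_compact_resolvent A.
have [e [l [he complete Ae]]] :=
  eigenbasis A_sa T_res T_comp H_separable H_infinite_dim.
have graphA : graph A = diagonal_graph e l.
  by apply/seteqP; split=> -[x y] /(graph_coordP A_sa T_res complete Ae).
have [d /= d0 dU] : exists2 d : R, 0 < d & ball (graph_projection A) d `<=` U.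
  by apply/nbhs_ballP; exact: open_nbhs_nbhs.
(* When [|l| > 4 / d], a sign flip costs [2 |l| / (1 + l^2) <= d / 2]; the remaining half makes the
   distance strictly less than [d]. *)
have [m mP] := eigenvalues_unbounded T_res T_comp he complete Ae (4 / d).
pose mu n := if (n < m)%N then l n else (-1) ^+ sg n * `|l n|.
have mul n : mu n ^+ 2 = l n ^+ 2.
  by rewrite /mu; case: ifP => // _; rewrite exprMn sqrr_sign mul1r real_normK
    ?num_real.
have [B graphB] := diagonal_regular he complete mu.
have T_diag : diagonal_op e (fun n => (1 + mu n ^+ 2)^-1) T.
  by move=> x n; rewrite (resolvent_coord A_sa T_res Ae) mul.
(* The same [T] serves as resolvent of [B], so its compactness is inherited. *)
pose B' := RKSA (diagonal_self_adjoint he complete graphB)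
  (ex_intro2 _ _ T (diagonal_resolvent_graph he complete graphB T_diag) T_comp).
exists e, mu, B', m; split=> //; last first.
  move=> n mn; rewrite /mu ltnNge mn /= mulrA -expr2 sqrr_sign mul1r.
  by rewrite (le_lt_trans _ (mP n mn)) // divr_ge0 // ltW.
apply: dU; rewrite ballEmdist /=.
have d20 : 0 <= d / 2 by rewrite divr_ge0 // ltW.
suff : mdist (graph_projection A) (graph_projection B) <= d / 2.
  by move=> h; rewrite (le_lt_trans h) // ltr_pdivrMr // mulr_natr mulr2n ltrDl.
apply: (graph_projection_dist he complete graphA graphB) => // n.
rewrite /mu; case: ltnP => mn; first by rewrite subrr normr0 mul0r.
have ln0 : 0 <= `|l n| by exact: normr_ge0.
have lmu : `|l n - (-1) ^+ sg n * `|l n| | <= 2 * `|l n|.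
  by rewrite (le_trans (ler_normB _ _)) // normrM normrX normrN1 expr1n mul1r
    normr_id mulr2n mulrDl mul1r.
rewrite ler_pdivrMr ?ltr_pwDl ?sqr_ge0 // (le_trans lmu) //.
rewrite -[X in _ + X]real_normK ?num_real //.
have := mP n mn; rewrite ltr_pdivrMr // => h.
have h2 : 4 * `|l n| <= `|l n| * d * `|l n| by rewrite ler_wpM2r // ltW.
by nra.
Qed.

End Perturbation.

Theorem theorem8p1 (R : realType) (H : hilbertType R)
    (H_separable : exists2 D : set H, countable D & dense D)
    (H_infinite_dim : ~ finite_dim H) :
  [/\ dense (RKminus H), dense (RKplus H) & dense (RKstar H)].
Proof.
split=> O [A OA] oO.
- have [e [mu [B [m [he complete OB graphB mum]]]]] :=
    perturbation H_separable H_infinite_dim (fun _ => true) oO OA.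
  exists B; split=> //; apply:
    (diagonal_ess_negative he complete graphB (m := m)).
  by move=> n /mum; rewrite expr1 mulN1r oppr_gt0 => /ltW.
- have [e [mu [B [m [he complete OB graphB mum]]]]] :=
    perturbation H_separable H_infinite_dim (fun _ => false) oO OA.
  exists B; split=> //; apply:
    (diagonal_ess_positive he complete graphB (m := m)).
  by move=> n /mum; rewrite expr0 mul1r => /ltW.
- have [e [mu [B [m [he complete OB graphB mum]]]]] :=
    perturbation H_separable H_infinite_dim odd oO OA.
  exists B; split=> // -[] [F BF].
    (* Doubling [i + m] gives indices of known parity that are all at least [m]: the odd ones carry
       negative eigenvalues, the even ones positive eigenvalues. *)
    apply: (not_ess_positive he complete graphB (f := fun i => (i + m).*2.+1))
      BF.
      by move=> i j /succn_inj/double_inj/addIn.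
    move=> i; have := mum (i + m).*2.+1; rewrite /= odd_double expr1 mulN1r
      oppr_gt0.
    by apply; rewrite -addnn -addSn (leq_trans _ (leq_addl _ _)) // leq_addl.
  apply: (not_ess_negative he complete graphB (f := fun i => (i + m).*2)) BF.
    by move=> i j /double_inj/addIn.
  move=> i; have := mum (i + m).*2; rewrite odd_double expr0 mul1r.
  by apply; rewrite -addnn (leq_trans _ (leq_addl _ _)) // leq_addl.
Qed.
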